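(* Let $(K,v)$ be a henselian valued field of arbitrary rank, let $w$ be an extension of $v$ to $K(X)$, and let $Q$ be any abstract key polynomial (ABKP) for $w$ such that $w_Q<w$. Then the following hold. (i) A polynomial $F\in K[X]$ is a trivial lifting, with respect to $w_Q$, of some monic irreducible polynomial $G(Y)\neq Y$ in $k_{v_1}[Y]\subseteq k_{w_Q}$ if and only if $F\in\psi(Q)$ and $\deg F=\deg Q$. (ii) If $F\in\psi(Q)$ and $\deg F>\deg Q$, then $F$ is a non-trivial lifting, with respect to $w_Q$, of some monic polynomial $G(Y)\neq Y$ in $k_{v_1}[Y]\subseteq k_{w_Q}$.
   Context: Fix an extension $\bar v$ of $v$ to an algebraic closure $\overline K$ of $K$. For a valuation $u$, $\Gamma_u$ denotes its value group and $k_u$ its residue field. Let $\overline w$ be a common extension of $w$ and $\bar v$ to $\overline K(X)$. For $f\in K[X]$ and a positive integer $b$, $\partial_b f=\frac{1}{b!}\frac{\partial^b f}{\partial X^b}$ is the $b$-th formal (Hasse) derivative, and $\epsilon(f)=\max_{b\in\mathbb N}\frac{w(f)-w(\partial_b f)}{b}$, where $\mathbb N$ is the set of positive integers (an element of the divisible hull of $\Gamma_w$; terms with $\partial_b f=0$ count as $-\infty$). A monic nonconstant polynomial $Q\in K[X]$ is an abstract key polynomial (ABKP) for $w$ if every $f\in K[X]$ with $\epsilon(f)\ge\epsilon(Q)$ satisfies $\deg f\ge\deg Q$. ABKPs are irreducible over $K$. The $Q$-truncation of $w$ is $w_Q(f)=\min_i\{w(f_iQ^i)\}$, where $f=\sum_i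 f_iQ^i$, $\deg f_i<\deg Q$, is the $Q$-expansion of $f$; for an ABKP $Q$ it is a valuation on $K(X)$, and $w_Q\le w$ on $K[X]$. Write $w_Q<w$ if $w_Q\ne w$. Put $\alpha(Q)=\min\{\deg f\mid w_Q(f)<w(f)\}$ ($=\infty$ if $w_Q=w$) and $\psi(Q)=\{f\in K[X]\mid f\text{ monic},\ w_Q(f)<w(f),\ \deg f=\alpha(Q)\}$. Lifting with respect to $w_Q$. Let $\alpha$ be an optimizing root of $Q$, i.e. a root of $Q$ in $\overline K$ with $\overline w(X-\alpha)$ maximal among the roots of $Q$, and let $\delta(Q)=\overline w(X-\alpha)$. When $w_Q<w$, $w_Q$ is a residually transcendental extension of $v$ (i.e. $k_{w_Q}/k_v$ is transcendental), and it is the restriction to $K(X)$ of the valuation $\overline w_{\alpha,\delta(Q)}\left(\sum_i c_i(X-\alpha)^i\right)=\min_i\{\bar v(c_i)+i\,\delta(Q)\}$ on $\overline K(X)$. Let $n=\deg Q$ ($Q$ is the minimal polynomial of $\alpha$ over $K$), $\gamma=w_Q(Q)$, $v_1=\bar v|_{K(\alpha)}$, and let $e$ be the smallest positive integer with $e\gamma\in\Gamma_{v_1}$. Let $h\in K[X]$ be a polynomial with $\deg h<n$ and $w_Q(h)=v_1(h(\alpha))=e\gamma$. The $w_Q$-residue $Y$ of $Q^e/h$ is transcendental over $k_{v_1}$ and $k_{w_Q}=k_{v_1}(Y)$. A monic polynomial $F\in K[X]$ is a lifting, with respect to $w_Q$, of a monic polynomial $G(Y)\in k_{v_1}[Y]$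 of degree $m\ge1$ if: $\deg F=emn$; $w_Q(F)=w_Q(h^m)=em\gamma$; and the $w_Q$-residue of $F/h^m$ equals $G(Y)$. The lifting is trivial if $\deg F=\deg Q$, i.e. $\deg G=1$ and $\gamma\in\Gamma_{v_1}$; otherwise it is non-trivial.
   Formalization: In (i), ''some monic irreducible G(Y)≠Y'' is read as one G, fixed for all F: there is such a G so that F is a trivial lifting of G iff F∈ψ(Q) and deg F=deg Q; with G allowed to depend on F, the ''only if'' direction is false. *)

(* Defs.v *)
From HB Require Import structures.
From mathcomp Require Import all_boot all_order all_algebra all_field.
From mathcomp Require Import fraction generic_quotient ring_quotient.

Set Implicit Arguments.
Unset Strict Implicit.
Unset Printing Implicit Defensive.

Import Order.TTheory GRing.Theory Num.Theory.
Local Open Scope ring_scope.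

(* Totally ordered Q-vector spaces, i.e. divisible totally ordered abelian
   groups. Every totally ordered abelian group embeds in its divisible hull, so
   letting valuations take their values in such a V (and calling value group
   the image) is no restriction on the rank or on the value groups. *)
HB.mixin Record Lmodule_isOrdered (V : Type) of Num.POrderedZmodule V
    & GRing.Lmodule rat V := {
  ordq_total : total (<=%R : rel V);
  ordq_leD : forall x y z : V, x <= y -> z + x <= z + y
}.

#[short(type="ordQVectType")]
HB.structure Definition OrdQVect :=
  {V of Num.POrderedZmodule V & GRing.Lmodule rat V & Lmodule_isOrdered V}.

Definition withtop (T : Type) : Type := option T.
Definition withbot (T : Type) : Type := option T.
Definition Fin (T : Type) (x : T) : withtop T := Some x.
Definition top (T : Type) : withtop T := None.
Definition Finb (T : Type) (x : T) : withbot T := Some x.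
Definition bot (T : Type) : withbot T := None.
Arguments top {T}.
Arguments bot {T}.

HB.instance Definition _ (T : choiceType) :=
  Choice.copy (withtop T) (option T).
HB.instance Definition _ (T : choiceType) :=
  Choice.copy (withbot T) (option T).

Section WithTop.
Variable V : ordQVectType.
Implicit Types (a b c : V) (x y z : withtop V).

Definition wt_le x y : bool :=
  match x, y with
  | _, None => true
  | None, Some _ => false
  | Some a, Some b => a <= b
  end.

Lemma wt_le_refl : reflexive wt_le. Proof. by case=> /=. Qed.
Lemma wt_le_anti : antisymmetric wt_le.
Proof. by move=> [a|] [b|] //= /le_anti ->. Qed.
Lemma wt_le_trans : transitive wt_le.
Proof. by move=> [a|] [b|] [c|] //=; apply: le_trans. Qed.
Lemma wt_le_total : total wt_le.
Proof. by move=> [a|] [b|] //=; apply: ordq_total. Qed.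

HB.instance Definition _ := Order.Le_isPOrder.Build ring_display (withtop V)
  wt_le_refl wt_le_anti wt_le_trans.
HB.instance Definition _ := Order.POrder_isTotal.Build ring_display (withtop V)
  wt_le_total.

Definition wt_add x y : withtop V :=
  if x is Some a then (if y is Some b then Fin (a + b) else top) else top.

Lemma wt_addA : associative wt_add.
Proof. by move=> [a|] [b|] [c|] //=; rewrite addrA. Qed.
Lemma wt_addC : commutative wt_add.
Proof. by move=> [a|] [b|] //=; rewrite addrC. Qed.
Lemma wt_add0 : left_id (Fin 0) wt_add.
Proof. by move=> [a|] //=; rewrite add0r. Qed.

HB.instance Definition _ := GRing.isNmodule.Build (withtop V)
  wt_addA wt_addC wt_add0.

(* junk value 0 at infinity *)
Definition fin x : V := odflt 0 x.

End WithTop.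

Section WithBot.
Variable V : ordQVectType.
Implicit Types (a b c : V) (x y z : withbot V).

Definition wb_le x y : bool :=
  match x, y with
  | None, _ => true
  | Some _, None => false
  | Some a, Some b => a <= b
  end.

Lemma wb_le_refl : reflexive wb_le. Proof. by case=> /=. Qed.
Lemma wb_le_anti : antisymmetric wb_le.
Proof. by move=> [a|] [b|] //= /le_anti ->. Qed.
Lemma wb_le_trans : transitive wb_le.
Proof. by move=> [a|] [b|] [c|] //=; apply: le_trans. Qed.
Lemma wb_le_total : total wb_le.
Proof. by move=> [a|] [b|] //=; apply: ordq_total. Qed.

HB.instance Definition _ := Order.Le_isPOrder.Build ring_display (withbot V)
  wb_le_refl wb_le_anti wb_le_trans.
HB.instance Definition _ := Order.POrder_isTotal.Build ring_display (withbot V)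
  wb_le_total.

End WithBot.

Section OrdTheory.
Variable V : ordQVectType.
Implicit Types (a b c d : V) (x y z t : withtop V).

Lemma Fin_le a b : (Fin a <= Fin b) = (a <= b). Proof. by []. Qed.
Lemma FinD a b : Fin a + Fin b = Fin (a + b). Proof. by []. Qed.
Lemma addtop x : x + top = top. Proof. by case: x. Qed.
Lemma topadd x : top + x = top. Proof. by []. Qed.
Lemma le_topr x : x <= top. Proof. by case: x. Qed.
Lemma finK x : x != top -> Fin (fin x) = x. Proof. by case: x. Qed.

Lemma ordq_leD2 a b c d : a <= b -> c <= d -> a + c <= b + d.
Proof.
move=> ab cd; apply: (@le_trans _ _ (b + c)); last exact: ordq_leD.
by rewrite ![_ + c]addrC; apply: ordq_leD.
Qed.

Lemma wt_leD x y z t : x <= y -> z <= t -> x + z <= y + t.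
Proof.
by case: x y z t => [a|] [b|] [c|] [d|] //=; apply: ordq_leD2.
Qed.

Lemma wt_addIr z : z != top -> injective (fun x => x + z).
Proof.
case: z => // c _ [a|] [b|] //= [/(congr1 (fun d => d - c))].
by rewrite !addrK => ->.
Qed.

Lemma wt_ltD x y z t : z != top -> x < y -> z <= t -> x + z < y + t.
Proof.
move=> zT xy zt; apply: lt_le_trans (wt_leD (lexx y) zt).
rewrite lt_neqAle wt_leD ?(ltW xy) // andbT.
by apply: contraTneq xy => /(wt_addIr zT) ->; rewrite ltxx.
Qed.

Lemma FinMn a n : Fin a *+ n = Fin (a *+ n).
Proof. by elim: n => // n IH; rewrite !mulrS IH. Qed.

Lemma Fin0 : Fin (0 : V) = 0. Proof. by []. Qed.

Lemma wt_add_eqtop x y : (x + y == top) = (x == top) || (y == top).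
Proof. by case: x y => [a|] [b|]. Qed.

End OrdTheory.

(* Additive valuations, of arbitrary rank. R need not be a field, so that a
   valuation of L(X) can be built from one of L[X] (see gauss below). *)
Record valuation (V : ordQVectType) (R : idomainType) := Valuation {
  val_fun :> R -> withtop V;
  val_eqtop : forall x, (val_fun x == top) = (x == 0);
  valM : forall x y, val_fun (x * y) = val_fun x + val_fun y;
  val_leD : forall x y, Order.min (val_fun x) (val_fun y) <= val_fun (x + y)
}.

Section ValuationTheory.
Variables (V : ordQVectType) (R : idomainType) (u : valuation V R).
Implicit Types x y : R.

Lemma val0 : u 0 = top. Proof. by apply/eqP; rewrite val_eqtop. Qed.

Lemma val_neqtop x : (u x != top) = (x != 0). Proof. by rewrite val_eqtop. Qed.

Lemma val1 : u 1 = 0.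
Proof.
have := valM u 1 1; rewrite mulr1; have := val_neqtop 1; rewrite oner_neq0.
case: (u 1) => //= a _ [/(congr1 (fun b => b - a))].
by rewrite addrK subrr => <-.
Qed.

Lemma valN x : u (- x) = u x.
Proof.
rewrite -mulN1r valM; suff -> : u (-1) = 0 by rewrite add0r.
have : u (-1) + u (-1) = 0 by rewrite -valM mulrNN mulr1 val1.
case: (u (-1)) => //= a [aa].
have /(congr1 (fun b => 2%:R^-1 *: b)) : (2%:R : rat) *: a = 0.
  by rewrite scaler_nat mulr2n.
by rewrite scalerA mulVf // scale1r scaler0 => ->.
Qed.

Lemma valX x n : u (x ^+ n) = u x *+ n.
Proof. by elim: n => [|n IH]; rewrite ?val1 // exprS mulrS valM IH. Qed.

Lemma val_le_sum (I : Type) (r : seq I) (P : pred I) (F : I -> R) g :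
  (forall i, P i -> g <= u (F i)) -> g <= u (\sum_(i <- r | P i) F i).
Proof.
move=> gF; elim/big_rec: _ => [|i x Pi gx]; first by rewrite val0 le_topr.
by apply: le_trans (val_leD u _ _); rewrite le_min gF.
Qed.

Lemma val_lt_sum (I : Type) (r : seq I) (P : pred I) (F : I -> R) g :
  g < top -> (forall i, P i -> g < u (F i)) -> g < u (\sum_(i <- r | P i) F i).
Proof.
move=> gT gF; elim/big_rec: _ => [|i x Pi gx]; first by rewrite val0.
by apply: lt_le_trans (val_leD u _ _); rewrite lt_min gF.
Qed.

Lemma val_addl x y : u x < u y -> u (x + y) = u x.
Proof.
move=> xy; apply/le_anti/andP; split; last first.
  by apply: le_trans (val_leD u x y); rewrite le_min lexx ltW.
have := val_leD u (x + y) (- y); rewrite addrK valN ge_min.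
by case/orP => //; rewrite leNgt xy.
Qed.

End ValuationTheory.

Definition extends (V : ordQVectType) (R S : idomainType) (phi : R -> S)
    (v : valuation V R) (u : valuation V S) : Prop :=
  forall x, u (phi x) = v x.

Definition in_value_group (V : ordQVectType) (R : idomainType)
    (u : valuation V R) (g : withtop V) : Prop :=
  exists2 x, x != 0 & u x = g.

Section Restriction.
Variables (V : ordQVectType) (F : fieldType) (L : idomainType).
Variables (phi : {rmorphism F -> L}) (u : valuation V L).

Lemma restr_eqtop x : (u (phi x) == top) = (x == 0).
Proof. by rewrite val_eqtop fmorph_eq0. Qed.
Lemma restrM x y : u (phi (x * y)) = u (phi x) + u (phi y).
Proof. by rewrite rmorphM valM. Qed.
Lemma restr_leD x y : Order.min (u (phi x)) (u (phi y)) <= u (phi (x + y)).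
Proof. by rewrite rmorphD val_leD. Qed.

Definition restr : valuation V F := Valuation restr_eqtop restrM restr_leD.

End Restriction.

Section Fractions.
Variable R : idomainType.
Implicit Types (p q : R) (x : {fraction R}).

Definition fnum x : R := \n_(repr x).
Definition fden x : R := \d_(repr x).

Lemma fden_neq0 x : fden x != 0. Proof. exact: denom_ratioP. Qed.

Lemma fracE x : x = tofrac (fnum x) / tofrac (fden x).
Proof.
have d0 : tofrac (fden x) != 0 by rewrite tofrac_eq0 fden_neq0.
apply/(mulIf d0); rewrite divfK //; rewrite /fnum -{1}[x]reprK.
unlock FracField.tofrac.
rewrite -[LHS]FracField.pi_mul; apply/eqmodP => /=.
rewrite FracField.equivfE /FracField.mulf.
rewrite !numden_Ratio ?mulf_neq0 ?oner_eq0 ?denom_ratioP //.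
by rewrite /fden !mulr1 mulrC.
Qed.

End Fractions.

Section FracValuation.
Variables (V : ordQVectType) (R : idomainType) (u : valuation V R).
Implicit Types (p q : R) (x y : {fraction R}).

Definition fracval_fun x : withtop V :=
  if x == 0 then top else Fin (fin (u (fnum x)) - fin (u (fden x))).

Lemma fracval_fun_div p q : q != 0 ->
  fracval_fun (tofrac p / tofrac q) + u q = u p.
Proof.
move=> q0; have [->|p0] := eqVneq p 0.
  by rewrite tofrac0 mul0r /fracval_fun eqxx val0.
set x := _ / _; have x0 : x != 0.
  by rewrite mulf_neq0 ?invr_neq0 ?tofrac_eq0.
rewrite /fracval_fun (negPf x0).
have d0 := fden_neq0 x.
have n0 : fnum x != 0.
  by apply: contraNneq x0 => n0; rewrite [x]fracE n0 tofrac0 mul0r.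
have : u (fnum x * q) = u (p * fden x).
  congr (u _); apply/eqP; rewrite -tofrac_eq !tofracM -eqr_div ?tofrac_eq0 //.
  by rewrite -fracE.
rewrite !valM; move: (val_neqtop u p) (val_neqtop u q).
rewrite p0 q0; move: (val_neqtop u (fnum x)) (val_neqtop u (fden x)).
rewrite d0 n0; move: (u (fnum x)) (u (fden x)) (u p) (u q).
move=> [a|] // [b|] // [c|] // [d|] // _ _ _ _ [E].
by congr Some; rewrite /= addrAC E addrK.
Qed.

Lemma fracval_eqtop x : (fracval_fun x == top) = (x == 0).
Proof. by rewrite /fracval_fun; case: (x == 0). Qed.

Lemma fracval_M x y : fracval_fun (x * y) = fracval_fun x + fracval_fun y.
Proof.
have [a [b [c [d [b0 d0 -> ->]]]]] : exists a b c d, [/\ b != 0, d != 0,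
   x = tofrac a / tofrac b & y = tofrac c / tofrac d].
  exists (fnum x), (fden x), (fnum y), (fden y).
  by split; rewrite ?fden_neq0 -?fracE.
have bd0 : b * d != 0 by rewrite mulf_neq0.
apply: (@wt_addIr _ (u (b * d))); first by rewrite val_neqtop.
rewrite mulf_div -!tofracM fracval_fun_div // !valM addrACA.
by rewrite !fracval_fun_div.
Qed.

Lemma fracval_leD x y :
  Order.min (fracval_fun x) (fracval_fun y) <= fracval_fun (x + y).
Proof.
have [a [b [c [d [b0 d0 -> ->]]]]] : exists a b c d, [/\ b != 0, d != 0,
   x = tofrac a / tofrac b & y = tofrac c / tofrac d].
  exists (fnum x), (fden x), (fnum y), (fden y).
  by split; rewrite ?fden_neq0 -?fracE.
have bd0 : b * d != 0 by rewrite mulf_neq0.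
have ubd : u (b * d) != top by rewrite val_neqtop.
have leI s t : s + u (b * d) <= t + u (b * d) -> s <= t.
  rewrite !leNgt; apply: contra => ts; exact: wt_ltD.
apply: leI; rewrite addf_div ?tofrac_eq0 // -!tofracM -tofracD.
rewrite fracval_fun_div //; apply: le_trans (val_leD u _ _).
rewrite le_min; apply/andP; split.
  rewrite -(@fracval_fun_div (a * d) (b * d)) // !tofracM -mulf_div.
  by rewrite divff ?tofrac_eq0 // mulr1 wt_leD // ge_min lexx.
rewrite -(@fracval_fun_div (c * b) (b * d)) // !tofracM.
rewrite [tofrac b * tofrac d]mulrC -mulf_div.
by rewrite divff ?tofrac_eq0 // mulr1 wt_leD // ge_min lexx orbT.
Qed.

Definition fracval : valuation V {fraction R} :=
  Valuation fracval_eqtop fracval_M fracval_leD.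

Lemma fracval_tofrac p : fracval (tofrac p) = u p.
Proof.
rewrite -[RHS](@fracval_fun_div p 1) ?oner_eq0 // val1 addr0.
by rewrite tofrac1 invr1 mulr1.
Qed.

End FracValuation.

Section RatMap.
Variables (K L : fieldType) (phi : {rmorphism K -> L}).

(* K(X) -> L(X) induced by phi : K -> L *)
Definition ratmap (x : {fraction {poly K}}) : {fraction {poly L}} :=
  tofrac (map_poly phi (fnum x)) / tofrac (map_poly phi (fden x)).

Lemma ratmap_div (p q : {poly K}) : q != 0 -> ratmap (tofrac p / tofrac q) =
  tofrac (map_poly phi p) / tofrac (map_poly phi q).
Proof.
move=> q0; rewrite /ratmap; set x := tofrac p / tofrac q.
have d0 := fden_neq0 x.
apply/eqP; rewrite eqr_div ?tofrac_eq0 ?map_poly_eq0 //.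
rewrite -!tofracM tofrac_eq -!rmorphM /=; apply/eqP; congr map_poly.
apply/eqP; rewrite -tofrac_eq !tofracM -eqr_div ?tofrac_eq0 //.
by rewrite -fracE.
Qed.

Lemma ratmap_tofrac p : ratmap (tofrac p) = tofrac (map_poly phi p).
Proof.
rewrite -[tofrac p]divr1 -tofrac1 ratmap_div ?oner_eq0 //.
by rewrite rmorph1 tofrac1 divr1.
Qed.

Lemma ratmap_is_zmod_morphism : zmod_morphism ratmap.
Proof.
move=> x y; rewrite [x]fracE [y]fracE.
move: (fnum x) (fden x) (fden_neq0 x) => a b b0.
move: (fnum y) (fden y) (fden_neq0 y) => c d d0.
rewrite -mulNr -tofracN addf_div ?tofrac_eq0 // -!tofracM -tofracD.
rewrite !ratmap_div ?mulf_neq0 // -[in RHS]mulNr -[in RHS]tofracN.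
rewrite addf_div ?tofrac_eq0 ?map_poly_eq0 //.
by rewrite !(rmorphM, rmorphD, rmorphN).
Qed.

Lemma ratmap_is_monoid_morphism : monoid_morphism ratmap.
Proof.
split=> [|x y]; first by rewrite -tofrac1 ratmap_tofrac rmorph1.
rewrite [x]fracE [y]fracE.
move: (fnum x) (fden x) (fden_neq0 x) => a b b0.
move: (fnum y) (fden y) (fden_neq0 y) => c d d0.
rewrite mulf_div -!tofracM !ratmap_div ?mulf_neq0 // mulf_div.
by rewrite !rmorphM.
Qed.

HB.instance Definition _ := GRing.isZmodMorphism.Build _ _ ratmap
  ratmap_is_zmod_morphism.
HB.instance Definition _ := GRing.isMonoidMorphism.Build _ _ ratmap
  ratmap_is_monoid_morphism.

End RatMap.

Definition ratC (L : fieldType) (c : L) : {fraction {poly L}} := tofrac c%:P.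

Section RatC.
Variable L : fieldType.
Lemma ratC_is_zmod_morphism : zmod_morphism (@ratC L).
Proof. by move=> x y; rewrite /ratC polyCB tofracB. Qed.
Lemma ratC_is_monoid_morphism : monoid_morphism (@ratC L).
Proof. by split=> [|x y]; rewrite /ratC ?polyC1 ?tofrac1 // polyCM tofracM. Qed.
HB.instance Definition _ := GRing.isZmodMorphism.Build _ _ (@ratC L)
  ratC_is_zmod_morphism.
HB.instance Definition _ := GRing.isMonoidMorphism.Build _ _ (@ratC L)
  ratC_is_monoid_morphism.
End RatC.

Section Gauss.
Variables (V : ordQVectType) (L : fieldType) (u : valuation V L).
Variables (a : L) (d : V).
Implicit Types p q : {poly L}.

Definition gterm p (i : nat) : withtop V := u p`_i + Fin (d *+ i).

Definition gauss0 p : withtop V := \big[Order.min/top]_(i < size p) gterm p i.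

Lemma gauss0_le p i : gauss0 p <= gterm p i.
Proof.
have [ip|pi] := ltnP i (size p); first exact: (bigmin_le _ (Ordinal ip)).
by rewrite /gterm nth_default // val0 le_topr.
Qed.

Lemma gauss0_ge p g : (forall i, g <= gterm p i) -> g <= gauss0 p.
Proof. by move=> gp; apply/bigmin_geP; split; rewrite ?le_topr. Qed.

Lemma gterm_eqtop p i : (gterm p i == top) = (p`_i == 0).
Proof. by rewrite wt_add_eqtop val_eqtop orbF. Qed.

Lemma gauss0_attained p : p != 0 -> exists2 i, gterm p i = gauss0 p &
  forall j, (j < i)%N -> gauss0 p < gterm p j.
Proof.
move=> p0; have sp : (0 < size p)%N by rewrite size_poly_gt0.
have ex : exists i, gterm p i == gauss0 p.
  have [] := @eq_bigmin _ _ 'I_(size p) top (Ordinal sp) xpredT (gterm p) => //.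
    by move=> i _; apply: le_topr.
  by move=> i _ E; exists i; rewrite -E.
case: (ex_minnP ex) => i /eqP gi imin; exists i => // j ji.
rewrite lt_neqAle gauss0_le andbT eq_sym; apply: contraTN ji => /imin.
by rewrite -leqNgt.
Qed.

Lemma gauss0_eqtop p : (gauss0 p == top) = (p == 0).
Proof.
have [->|p0] := eqVneq p 0.
  by rewrite /gauss0 size_poly0 big_ord0 eqxx.
apply/negP => /eqP g0; have := gauss0_le p (size p).-1.
rewrite g0 => /(le_trans (le_topr top)) tp.
have : gterm p (size p).-1 == top by rewrite eq_le tp le_topr.
by rewrite gterm_eqtop -lead_coefE lead_coef_eq0 (negPf p0).
Qed.

Lemma gauss0_leD p q : Order.min (gauss0 p) (gauss0 q) <= gauss0 (p + q).
Proof.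
apply: gauss0_ge => i; rewrite /gterm coefD.
apply: le_trans (wt_leD (val_leD u _ _) (lexx _)).
case: (leP (u p`_i) (u q`_i)) => _; rewrite ge_min.
  by rewrite gauss0_le.
by rewrite (gauss0_le q) orbT.
Qed.

Lemma gterm_mul p q i j : 
  gterm p i + gterm q j = u (p`_i * q`_j) + Fin (d *+ (i + j)).
Proof. by rewrite /gterm valM mulrnDr -FinD addrACA. Qed.

Lemma gauss0_M p q : gauss0 (p * q) = gauss0 p + gauss0 q.
Proof.
have [->|p0] := eqVneq p 0.
  have /eqP -> : gauss0 0 == top by rewrite gauss0_eqtop.
  by apply/eqP; rewrite mul0r gauss0_eqtop.
have [->|q0] := eqVneq q 0.
  have /eqP E : gauss0 0 == top by rewrite gauss0_eqtop.
  by rewrite mulr0 E addtop.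
have leI k s t : s + Fin (d *+ k) <= t + Fin (d *+ k) -> s <= t.
  by rewrite !leNgt; apply: contra => ts; apply: wt_ltD.
apply/le_anti/andP; split; last first.
  apply: gauss0_ge => k; rewrite /gterm coefM.
  apply: le_trans (_ : _ <= gauss0 p + gauss0 q + Fin (- d *+ k)
                            + Fin (d *+ k)) _.
    by rewrite -addrA FinD mulNrn addNr addr0.
  apply: wt_leD (lexx _); apply: val_le_sum => i _.
  apply: (leI k); rewrite -addrA FinD mulNrn addNr addr0.
  have -> : d *+ k = d *+ (i + (k - i)) by rewrite subnKC // -ltnS.
  rewrite -gterm_mul; apply: wt_leD; exact: gauss0_le.
have [i gi ilt] := gauss0_attained p0.
have [j gj jlt] := gauss0_attained q0.
apply: le_trans (gauss0_le _ (i + j)) _.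
rewrite -gi -gj gterm_mul /gterm; apply: wt_leD (lexx _).
have ltI k s t : s + Fin (d *+ k) < t + Fin (d *+ k) -> s < t.
  by rewrite !ltNge; apply: contra => ts; apply: wt_leD.
have pq0 : p`_i * q`_j != 0.
  rewrite mulf_neq0 // -(val_neqtop u).
    have := gauss0_eqtop p; rewrite (negPf p0) -gi gterm_eqtop val_neqtop.
    by move->.
  have := gauss0_eqtop q; rewrite (negPf q0) -gj gterm_eqtop val_neqtop.
  by move->.
have iij : (i < (i + j).+1)%N by rewrite ltnS leq_addr.
rewrite coefM (bigD1 (Ordinal iij)) //= addKn val_addl //.
apply: val_lt_sum => [|k ki].
  by rewrite lt_neqAle val_neqtop pq0 le_topr.
apply: (ltI (i + j)%N); rewrite -gterm_mul.
have -> : u (p`_k * q`_(i + j - k)) + Fin (d *+ (i + j)) =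
          gterm p k + gterm q (i + j - k).
  by rewrite gterm_mul subnKC // -ltnS.
rewrite gi gj; have qT : gauss0 q != top by rewrite gauss0_eqtop.
have pT : gauss0 p != top by rewrite gauss0_eqtop.
have : (k : nat) != i by apply: contra ki => /eqP ki; apply/eqP/val_inj.
case: ltngtP => // [ki' _|ik _].
  by apply: wt_ltD => //; [exact: ilt ki' | exact: gauss0_le].
rewrite addrC [ltRHS]addrC; apply: wt_ltD => //; last exact: gauss0_le.
have ltj : (i + j - k < j)%N.
  have kij : (k <= i + j)%N by rewrite -ltnS.
  by rewrite -(ltn_add2r k) subnK // [ltnRHS]addnC ltn_add2r.
exact: jlt ltj.
Qed.

Definition gauss_poly p := gauss0 (p \Po ('X + a%:P)).

Lemma gauss_poly_eqtop p : (gauss_poly p == top) = (p == 0).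
Proof. by rewrite gauss0_eqtop comp_poly2_eq0 // size_XaddC. Qed.
Lemma gauss_poly_M p q : gauss_poly (p * q) = gauss_poly p + gauss_poly q.
Proof. by rewrite /gauss_poly comp_polyM gauss0_M. Qed.
Lemma gauss_poly_leD p q :
  Order.min (gauss_poly p) (gauss_poly q) <= gauss_poly (p + q).
Proof. by rewrite /gauss_poly comp_polyD gauss0_leD. Qed.

(* The valuation sum_i c_i (X - a)^i |-> min_i (u c_i + i d) of L(X); the c_i
   are the coefficients of p \Po ('X + a%:P). *)
Definition gauss : valuation V {fraction {poly L}} :=
  fracval (Valuation gauss_poly_eqtop gauss_poly_M gauss_poly_leD).

End Gauss.

Section ResidueField.
Variables (V : ordQVectType) (L : fieldType) (u : valuation V L).
Implicit Types x y : L.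

Definition in_valring : {pred L} := fun x => (0 : withtop V) <= u x.

Lemma valring_subring : subring_closed in_valring.
Proof.
split=> [|x y ux uy|x y ux uy]; rewrite unfold_in.
- by rewrite val1.
- by apply: le_trans (val_leD u _ _); rewrite le_min valN; apply/andP.
- by rewrite valM -[0]addr0 wt_leD.
Qed.

HB.instance Definition _ := GRing.isSubringClosed.Build L in_valring
  valring_subring.

Record valring := ValRing { valring_val :> L; _ : valring_val \in in_valring }.

HB.instance Definition _ := [isSub for valring_val].
HB.instance Definition _ := [Choice of valring by <:].
HB.instance Definition _ := [SubChoice_isSubComNzRing of valring by <:].

Definition maxideal : {pred valring} := fun a => (0 : withtop V) < u (val a).

Lemma maxideal_idealr : idealr_closed maxideal.
Proof.
split=> [||a x y]; rewrite !unfold_in.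
- by rewrite rmorph0 val0.
- by rewrite rmorph1 val1 ltxx.
- move=> ux uy; rewrite rmorphD rmorphM; apply: lt_le_trans (val_leD u _ _).
  rewrite lt_min uy andbT valM addrC.
  have [->|ax0] := eqVneq (u (val a)) top; first by rewrite addtop.
  by rewrite -[0]addr0 wt_ltD //; case: a {ax0}.
Qed.

HB.instance Definition _ := isIdealr.Build valring maxideal maxideal_idealr.

Definition resfield := {ideal_quot maxideal}.

HB.instance Definition _ := GRing.ComNzRing.on resfield.

Definition valring_insub x : valring := insubd 0 x.

(* the residue of x; junk value 0 when x is not in the valuation ring *)
Definition res x : resfield := \pi_resfield%qT (valring_insub x).

(* some element of the valuation ring with a given residue *)
Definition lift_res (z : resfield) : L := val (repr z).

Lemma lift_res_ge0 z : (0 : withtop V) <= u (lift_res z).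
Proof. by rewrite /lift_res; case: (repr z). Qed.

Lemma res_lift z : res (lift_res z) = z.
Proof. by rewrite /res /lift_res /valring_insub valKd reprK. Qed.

Lemma valring_insubK x : (0 : withtop V) <= u x -> val (valring_insub x) = x.
Proof. by move=> ux; rewrite insubdK. Qed.

Lemma res_eq x y : (0 : withtop V) <= u x -> (0 : withtop V) <= u y ->
  (res x == res y) = ((0 : withtop V) < u (x - y)).
Proof.
move=> ux uy; rewrite /res -Quotient.idealrBE unfold_in rmorphB /=.
by rewrite !valring_insubK.
Qed.

Lemma resD x y : (0 : withtop V) <= u x -> (0 : withtop V) <= u y ->
  res (x + y) = res x + res y.
Proof.
move=> ux uy; rewrite /res -rmorphD /=; congr (\pi%qT _); apply: val_inj.
rewrite rmorphD /= !valring_insubK //.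
exact: (@rpredD _ in_valring).
Qed.

Lemma resM x y : (0 : withtop V) <= u x -> (0 : withtop V) <= u y ->
  res (x * y) = res x * res y.
Proof.
move=> ux uy; rewrite /res -rmorphM /=; congr (\pi%qT _); apply: val_inj.
rewrite rmorphM /= !valring_insubK //.
exact: (@rpredM _ in_valring).
Qed.

Lemma res0 : res 0 = 0.
Proof.
rewrite /res -[RHS](rmorph0 \pi_resfield%qT); congr (\pi%qT _); apply: val_inj.
by rewrite valring_insubK ?val0 // rmorph0.
Qed.

Lemma res1 : res 1 = 1.
Proof.
rewrite /res -[RHS](rmorph1 \pi_resfield%qT); congr (\pi%qT _); apply: val_inj.
by rewrite valring_insubK ?val1 // rmorph1.
Qed.

Definition resinv (z : resfield) : resfield := res (lift_res z)^-1.

Lemma resinv_mul (z : resfield) : z != 0 -> resinv z * z = 1.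
Proof.
move=> z0; have uz := lift_res_ge0 z.
have uz0 : u (lift_res z) = 0.
  apply/eqP; rewrite eq_le uz andbT leNgt; apply: contra z0 => uz0.
  by rewrite -[z]res_lift -res0 res_eq ?val0 ?subr0.
have z0' : lift_res z != 0 by rewrite -(val_neqtop u) uz0.
rewrite -[X in _ * X]res_lift -resM // ?mulVf ?res1 //.
have := valM u (lift_res z)^-1 (lift_res z).
by rewrite mulVf // val1 uz0 addr0 => <-.
Qed.

Lemma resinv0 : resinv 0 = 0.
Proof.
have uz := lift_res_ge0 0; have : (0 : withtop V) < u (lift_res 0).
  by rewrite -[lift_res 0]subr0 -res_eq ?val0 // res_lift res0.
rewrite /resinv; have [->|z0] := eqVneq (lift_res 0) 0.
  by rewrite invr0 res0.
move=> z1; rewrite /res /valring_insub /insubd insubF ?rmorph0 //.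
apply/negbTE; rewrite unfold_in -ltNge.
have := valM u (lift_res 0) (lift_res 0)^-1; rewrite divff // val1.
case: (u (lift_res 0)) z1 => // a a0; case: (u _^-1) => // b [E].
rewrite ltNge; apply: contraL a0 => b0; rewrite -leNgt.
have : (Fin a + 0 : withtop V) <= Fin a + Fin b by rewrite wt_leD.
by rewrite addr0 FinD -E.
Qed.

HB.instance Definition _ := GRing.ComNzRing_isField.Build resfield
  resinv_mul resinv0.

End ResidueField.

(* The map k_u -> k_u' induced by phi : L -> L' when u' extends u along phi. *)
Definition resmap (V : ordQVectType) (L L' : fieldType) (phi : L -> L')
    (u : valuation V L) (u' : valuation V L') (z : resfield u) : resfield u' :=
  res u' (phi (lift_res z)).
Arguments resmap {V L L'} phi u u' z.

Lemma resmap_res (V : ordQVectType) (L L' : fieldType)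
    (phi : {rmorphism L -> L'}) (u : valuation V L) (u' : valuation V L') x :
  extends phi u u' -> (0 : withtop V) <= u x ->
  resmap phi u u' (res u x) = res u' (phi x).
Proof.
move=> uu' ux; apply/eqP; rewrite res_eq ?uu' ?lift_res_ge0 //.
by rewrite -rmorphB uu' -res_eq ?lift_res_ge0 // res_lift.
Qed.

Definition alg_closure (K : fieldType) (Kbar : closedFieldType)
    (iota : {rmorphism K -> Kbar}) : Prop :=
  forall x : Kbar, algebraicOver iota x.

(* v has a unique extension to the algebraic closure. As V is divisible, every
   extension of v is equivalent to one with values in V, and two V-valued
   extensions of v that are equivalent are equal. *)
Definition henselian (V : ordQVectType) (K Kbar : fieldType) (iota : K -> Kbar)
    (v : valuation V K) : Prop :=
  forall u1 u2 : valuation V Kbar,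
    extends iota v u1 -> extends iota v u2 -> u1 =1 u2.

Section KeyPolynomials.
Variables (V : ordQVectType) (K : fieldType).
Variable w : valuation V {fraction {poly K}}.
Implicit Types f g Q F : {poly K}.

Definition wpol f : withtop V := w (tofrac f).

Definition eps_term f (b : nat) : withbot V :=
  if f^`N(b) == 0 then bot
  else Finb ((b%:R^-1 : rat) *: (fin (wpol f) - fin (wpol f^`N(b)))).

(* f^`N(b) = 0 for b >= size f *)
Definition epsilon f : withbot V :=
  \big[Order.max/bot]_(1 <= b < size f) eps_term f b.

Definition ABKP Q : Prop :=
  [/\ Q \is monic, (1 < size Q)%N
    & forall f, epsilon Q <= epsilon f -> (size Q <= size f)%N].

Definition qcoef Q f (i : nat) : {poly K} := (f %/ Q ^+ i) %% Q.

Lemma size_qcoef Q f i : (1 < size Q)%N -> (size (qcoef Q f i) < size Q)%N.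
Proof. by move=> Q1; rewrite ltn_modp -size_poly_gt0 ltnW. Qed.

Lemma qcoef_sum Q f : (1 < size Q)%N ->
  f = \sum_(i < size f) qcoef Q f i * Q ^+ i.
Proof.
move=> Q1; have Q0 : Q != 0 by rewrite -size_poly_gt0 ltnW.
have E n : f = \sum_(i < n) qcoef Q f i * Q ^+ i + (f %/ Q ^+ n) * Q ^+ n.
  elim: n => [|n IH]; first by rewrite big_ord0 add0r expr0 divp1 mulr1.
  rewrite big_ord_recr /= {1}IH -addrA; congr (_ + _).
  rewrite {1}(divp_eq (f %/ Q ^+ n) Q) mulrDl addrC -mulrA -exprS.
  by rewrite divp_divl -exprSr.
rewrite {1}(E (size f)) divp_small ?mul0r ?addr0 //.
rewrite (polySpred (expf_neq0 _ Q0)) size_exp ltnS leq_pmull //.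
by case: (size Q) Q1 => [|[]].
Qed.

(* w_Q; qcoef_sum shows that the Q-expansion has no term beyond size f *)
Definition trunc Q f : withtop V :=
  \big[Order.min/top]_(i < size f) wpol (qcoef Q f i * Q ^+ i).

(* w_Q < w; note that w_Q <= w for every ABKP Q *)
Definition trunc_proper Q : Prop := exists f, trunc Q f <> wpol f.

(* d = min {deg f | w_Q f < w f} *)
Definition is_alpha Q (d : nat) : Prop :=
  (exists2 f, trunc Q f < wpol f & (size f).-1 = d) /\
  (forall f, trunc Q f < wpol f -> (d <= (size f).-1)%N).

Definition psi Q F : Prop :=
  [/\ F \is monic, trunc Q F < wpol F & is_alpha Q (size F).-1].

End KeyPolynomials.

Section Lifting.
Variables (V : ordQVectType) (K : fieldType) (Kbar : closedFieldType).
Variables (iota : {rmorphism K -> Kbar}) (vbar : valuation V Kbar).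
Variable w : valuation V {fraction {poly K}}.
Variable wbar : valuation V {fraction {poly Kbar}}.
Variables (Q : {poly K}) (alpha : Kbar).
Implicit Types (F h : {poly K}) (e : nat).

Definition wbar_lin (beta : Kbar) : withtop V := wbar (tofrac ('X - beta%:P)).

Definition optimizing_root : Prop :=
  root (map_poly iota Q) alpha /\
  forall beta, root (map_poly iota Q) beta -> wbar_lin beta <= wbar_lin alpha.

(* K(alpha); subFExtend needs Q != 0 and alpha to be a root of Q. *)
Definition Kalpha : fieldType := subFExtend iota alpha Q.
Definition Kalpha_inj : {rmorphism Kalpha -> Kbar} :=
  GRing.RMorphism.clone _ _ (@subfx_inj K Kbar iota alpha Q) _.

Definition v1 : valuation V Kalpha := restr Kalpha_inj vbar.

Definition deltaQ : V := fin (wbar_lin alpha).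

(* The restriction of this valuation to K(X) is w_Q when w_Q < w; its residue
   field contains both k_{w_Q} and k_{v1}. *)
Definition wad : valuation V {fraction {poly Kbar}} := gauss vbar alpha deltaQ.

(* the w_Q-residue *)
Definition wQ_res (x : {fraction {poly K}}) : resfield wad :=
  res wad (ratmap iota x).

Definition kv1_emb : resfield v1 -> resfield wad :=
  resmap (fun x => ratC (Kalpha_inj x)) v1 wad.

Definition gammaQ : withtop V := trunc w Q Q.

(* e is the smallest positive integer with e gamma in the value group of v1 *)
Definition is_ramif e : Prop :=
  [/\ (0 < e)%N, in_value_group v1 (gammaQ *+ e)
    & forall e', (0 < e')%N -> in_value_group v1 (gammaQ *+ e') -> (e <= e')%N].

Definition is_normalizer e h : Prop :=
  [/\ (size h < size Q)%N, trunc w Q h = gammaQ *+ e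
    & vbar (map_poly iota h).[alpha] = gammaQ *+ e].

(* F is a lifting of G(Y), where Y is the w_Q-residue of Q^e / h *)
Definition lifting e h F (G : {poly resfield v1}) : Prop :=
  let n := (size Q).-1 in let m := (size G).-1 in
  [/\ F \is monic, G \is monic & (0 < m)%N] /\
  [/\ (size F).-1 = (e * m * n)%N,
      trunc w Q F = trunc w Q (h ^+ m),
      trunc w Q F = gammaQ *+ (e * m)
    & wQ_res (tofrac F / tofrac (h ^+ m)) =
      (map_poly kv1_emb G).[wQ_res (tofrac (Q ^+ e) / tofrac h)]].

Definition trivial_lifting e h F G : Prop :=
  lifting e h F G /\ (size F).-1 = (size Q).-1.

Definition nontrivial_lifting e h F G : Prop :=
  lifting e h F G /\ (size F).-1 <> (size Q).-1.

End Lifting.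

(* Main.v *)
Require Import Defs.
From HB Require Import structures.
From mathcomp Require Import all_boot all_order all_algebra all_field.
From mathcomp Require Import fraction.
From Stdlib Require Import Classical_Prop.

(** Write n for the degree of Q, a for the optimizing root, d for the value of
    X - a, and W for the Gauss valuation of centre a and radius d.

    The first point is that W restricts to the truncation on K[X] (truncE). The
    coefficients of p(T + X), as a polynomial in T, are the Hasse derivatives
    of p, and its roots are the b - X for b a root of p. Comparing this
    polynomial with its Gauss valuations of all radii shows that epsilon(p) is
    the greatest value of X - b over the roots b of p. Since Q is a key
    polynomial, the roots b of a polynomial r of degree less than n therefore
    satisfy w(X - b) < d (ABKP_root_lt), and X - b has the same initial form as
    the constant a - b, both for w and for W. Hence r has the same initial form
    as the constant r(a), and the values of r under w and W are both the value
    of r(a). Moreover W(f) is at most the value of f(a), which is that of the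
    remainder of f modulo Q; iterating, W(f) is at most the value of each term
    of the Q-expansion of f, and the ultrametric inequality gives the converse.

    The second point is the shape of a monic polynomial F of least degree with
    W(F) < w(F). The coefficient F_0 is dominant, otherwise F %/ Q would be a
    smaller such polynomial; so every dominant index i has i gamma in the value
    group of K(a), hence is a multiple of e. If I is the last dominant index
    and g is an inverse of F_I modulo Q, then reducing the coefficients of g F
    modulo Q changes nothing up to negligible terms, and gives a polynomial of
    degree I n on which W and w differ; hence F = Q^I + lower terms
    (minimal_size). Replacing each coefficient by the initial form of its value
    at a identifies the residue of F / h^m, where I = e m, with G(Y) for some
    monic G of degree m with nonzero constant term (minimal_lifts), so G is not
    the indeterminate. This is the second assertion.

    For the first assertion, G is the polynomial attached in this way to any
    such F. It is irreducible, since lifting a factorization of G to smaller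
    polynomials F1 and F2, on which W and w agree, would make F - F1 F2
    negligible and w(F1 F2) too large (lifts_minimal_irreducible). If F' is
    monic of degree n and F has degree n as well, then w and W agree on F - F',
    and both F' being a lifting of G and W(F') < w(F') say that F - F' is
    negligible (lifts_minimalP). *)

Set Implicit Arguments.
Unset Strict Implicit.
Unset Printing Implicit Defensive.

Import Order.TTheory GRing.Theory Num.Theory.
Local Open Scope ring_scope.

(** * Values and residues *)

Section OrderLemmas.
Variable V : ordQVectType.
Implicit Types x y z t : withtop V.

Lemma wt_leD2r z x y : z != top -> (x + z <= y + z) = (x <= y).
Proof.
move=> zT; case: (leP x y) => [xy|yx]; first by rewrite wt_leD.
by apply/negbTE; rewrite -ltNge wt_ltD.
Qed.

Lemma wt_leD2l z x y : z != top -> (z + x <= z + y) = (x <= y).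
Proof. by move=> zT; rewrite ![z + _]addrC wt_leD2r. Qed.

Lemma wt_ltD2r z x y : z != top -> (x + z < y + z) = (x < y).
Proof. by move=> zT; rewrite !ltNge wt_leD2r. Qed.

Lemma wt_ltD2l z x y : z != top -> (z + x < z + y) = (x < y).
Proof. by move=> zT; rewrite !ltNge wt_leD2l. Qed.

Lemma lt_neqtop x y : x < y -> x != top.
Proof. by apply: contraTneq => ->; rewrite -leNgt le_topr. Qed.

Lemma neqtop_lt x : x != top -> x < top.
Proof. by move=> xT; rewrite lt_neqAle xT le_topr. Qed.

Lemma mulrn_neqtop x n : x != top -> x *+ n != top.
Proof. by case: x => // a _; rewrite -/(Fin a) FinMn. Qed.

Lemma scale_invn_le (a d : V) (n : nat) : (0 < n)%N ->
  ((n%:R^-1 : rat) *: a <= d) = (a <= d *+ n).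
Proof.
case: n => // n _.
have mon (b c : V) k : b <= c -> b *+ k <= c *+ k.
  by move=> bc; elim: k => // k IH; rewrite !mulrS ordq_leD2.
have smon (b c : V) k : b < c -> b *+ k.+1 < c *+ k.+1.
  move=> bc; rewrite lt_neqAle mon ?(ltW bc) // andbT.
  apply: contraTneq bc => /(congr1 (fun z : V => (k.+1%:R^-1 : rat) *: z)).
  rewrite -!scaler_nat !scalerA mulVf ?pnatr_eq0 // !scale1r => ->.
  by rewrite ltxx.
have aE : a = ((n.+1%:R^-1 : rat) *: a) *+ n.+1.
  by rewrite -scaler_nat scalerA mulfV ?pnatr_eq0 // scale1r.
rewrite [in RHS]aE; set b := _ *: a.
have tot : (b <= d) || (d <= b) by apply: ordq_total.
apply/idP/idP => [/mon //|]; apply: contraTT => bd.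
have {}tot : d < b.
  rewrite lt_neqAle; move: tot; rewrite (negPf bd) /= => db; rewrite db andbT.
  by apply: contraNneq bd => ->.
by rewrite lt_geF // smon.
Qed.

End OrderLemmas.

Section ValuationLemmas.
Variables (V : ordQVectType) (R : idomainType) (u : valuation V R).
Implicit Types (x y : R) (g : withtop V).

Lemma val_geD g x y : g <= u x -> g <= u y -> g <= u (x + y).
Proof. by move=> gx gy; apply: le_trans (val_leD u x y); rewrite le_min gx. Qed.

Lemma val_gtD g x y : g < u x -> g < u y -> g < u (x + y).
Proof.
by move=> gx gy; apply: lt_le_trans (val_leD u x y); rewrite lt_min gx.
Qed.

Lemma val_geB g x y : g <= u x -> g <= u y -> g <= u (x - y).
Proof. by move=> gx gy; rewrite val_geD ?valN. Qed.

Lemma val_gtB g x y : g < u x -> g < u y -> g < u (x - y).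
Proof. by move=> gx gy; rewrite val_gtD ?valN. Qed.

Lemma valB_eq x y : u x < u (x - y) -> u y = u x.
Proof.
move=> xy; have -> : y = x + (y - x) by rewrite addrC subrK.
by rewrite val_addl // -[y - x]opprB valN.
Qed.

End ValuationLemmas.

Lemma div_exprD (F : fieldType) (r q h : F) k j :
  r * q ^+ j / h ^+ (k + j) = r / h ^+ k * (q / h) ^+ j.
Proof. by rewrite exprD invfM expr_div_n mulrACA. Qed.

Section FieldValuation.
Variables (V : ordQVectType) (F : fieldType) (u : valuation V F).
Implicit Types (x y : F) (g : withtop V).

Lemma le_val_div g x y : y != 0 -> (g <= u (x / y)) = (g + u y <= u x).
Proof.
move=> y0; rewrite -[in RHS](divfK y0 x) (Defs.valM u (x / y)) wt_leD2r //.
by rewrite val_neqtop.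
Qed.

Lemma lt_val_div g x y : y != 0 -> (g < u (x / y)) = (g + u y < u x).
Proof.
move=> y0; rewrite -[in RHS](divfK y0 x) (Defs.valM u (x / y)) wt_ltD2r //.
by rewrite val_neqtop.
Qed.

Lemma val_div g x y : y != 0 -> u x = g + u y -> u (x / y) = g.
Proof.
move=> y0 xy; have yT : u y != top by rewrite val_neqtop.
by apply: (wt_addIr yT); rewrite -Defs.valM divfK.
Qed.

Lemma res_sum (I : Type) (s : seq I) (P : pred I) (G : I -> F) :
  (forall i, P i -> (0 : withtop V) <= u (G i)) ->
  res u (\sum_(i <- s | P i) G i) = \sum_(i <- s | P i) res u (G i).
Proof.
move=> G0; elim: s => [|i s IH]; first by rewrite !big_nil res0.
rewrite !big_cons; case: ifP => // Pi.
by rewrite resD ?IH ?G0 // val_le_sum.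
Qed.

Lemma resX x k : (0 : withtop V) <= u x -> res u (x ^+ k) = res u x ^+ k.
Proof.
move=> x0; elim: k => [|k IH]; first by rewrite !expr0 res1.
rewrite !exprS resM ?IH // valX; elim: k {IH} => // k IH.
by rewrite mulrS -[0]addr0 wt_leD.
Qed.

End FieldValuation.

Section ResidueMap.
Variables (V : ordQVectType) (L L' : fieldType) (phi : {rmorphism L -> L'}).
Variables (u : valuation V L) (u' : valuation V L').
Hypothesis u'_u : extends phi u u'.
Local Notation f := (resmap phi u u').

Let lift_ge0 := @lift_res_ge0 V L u.
Let phi_lift_ge0 (z : resfield u) : (0 : withtop V) <= u' (phi (lift_res z)).
Proof. by rewrite u'_u lift_ge0. Qed.

Lemma resmapD : {morph f : x y / x + y}.
Proof.
move=> x y; rewrite -[x]res_lift -[y]res_lift -resD ?lift_ge0 //.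
rewrite !(resmap_res u'_u) ?val_geD ?lift_ge0 //.
by rewrite rmorphD resD ?phi_lift_ge0.
Qed.

Lemma resmap_zmod_morphism : zmod_morphism f.
Proof. by move=> x y; apply: (addIr (f y)); rewrite -resmapD !subrK. Qed.

Lemma resmap_monoid_morphism : monoid_morphism f.
Proof.
split=> [|x y].
  by rewrite -res1 (resmap_res u'_u) ?Defs.val1 // rmorph1 res1.
rewrite -[x]res_lift -[y]res_lift -resM ?lift_ge0 //.
rewrite !(resmap_res u'_u) ?lift_ge0 //.
  by rewrite rmorphM resM ?phi_lift_ge0.
by rewrite Defs.valM -[0]addr0 wt_leD ?lift_ge0.
Qed.

Definition resmap_rmorphism : {rmorphism resfield u -> resfield u'} :=
  HB.pack f (GRing.isZmodMorphism.Build _ _ f resmap_zmod_morphism)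
            (GRing.isMonoidMorphism.Build _ _ f resmap_monoid_morphism).

End ResidueMap.

(** * Taylor expansion and the invariant epsilon *)

Section Taylor.

Lemma coef_comp_XaddC (R : comNzRingType) (p : {poly R}) (c : R) i :
  (p \Po ('X + c%:P))`_i = p^`N(i).[c].
Proof.
rewrite /comp_poly addrC nderiv_taylor; last exact: mulrC.
rewrite coef_sum (eq_bigr (fun j : 'I__ => if i == j then p^`N(i).[c] else 0)).
  have [ip|pi] := ltnP i (size p^:P).
    rewrite (bigD1 (Ordinal ip)) //= eqxx big1 ?addr0 // => j.
    by rewrite -val_eqE eq_sym /= => /negPf ->.
  rewrite big1 => [|j _]; last by rewrite gtn_eqF ?(leq_trans (ltn_ord j)).
  by rewrite nderivn_poly0 ?horner0 // -(size_map_polyC p).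
move=> j _; rewrite nderivn_map horner_map coefCM coefXn.
by case: eqVneq => [->|]; rewrite ?mulr1 ?mulr0.
Qed.

Variables (V : ordQVectType) (L : fieldType).
Variable W : valuation V {fraction {poly L}}.
Implicit Types (p q : {poly L}) (d : V) (b : L).

Lemma horner_ratC_X p : (map_poly (@ratC L) p).[tofrac 'X] = tofrac p.
Proof.
elim/poly_ind: p => [|p c IH]; first by rewrite rmorph0 horner0 tofrac0.
by rewrite rmorphD rmorphM /= map_polyX map_polyC !hornerE IH tofracD tofracM.
Qed.

(** The polynomial p(T + X) of K(X)[T], whose coefficients are the Hasse
    derivatives of p and whose roots are the b - X for b a root of p. *)
Definition taylor p : {poly {fraction {poly L}}} :=
  map_poly (@ratC L) p \Po ('X + (tofrac 'X)%:P).

Lemma coef_taylor p i : (taylor p)`_i = tofrac p^`N(i).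
Proof. by rewrite coef_comp_XaddC nderivn_map horner_ratC_X. Qed.

Definition taylor_val d p : withtop V := gauss0 W d (taylor p).

Lemma taylor_valM d p q : taylor_val d (p * q) = taylor_val d p + taylor_val d q.
Proof. by rewrite -gauss0_M /taylor_val /taylor rmorphM comp_polyM. Qed.

Lemma taylor_val_le d p i :
  taylor_val d p <= W (tofrac p^`N(i)) + Fin (d *+ i).
Proof. by rewrite -coef_taylor; apply: gauss0_le. Qed.

Lemma taylor_val_le0 d p : taylor_val d p <= W (tofrac p).
Proof. by have := taylor_val_le d p 0; rewrite nderivn0 mulr0n addr0. Qed.

Lemma taylor_val_lin d b :
  taylor_val d ('X - b%:P) = Order.min (W (tofrac ('X - b%:P))) (Fin d).
Proof.
apply/le_anti/andP; split.
  rewrite le_min taylor_val_le0 /=.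
  apply: le_trans (taylor_val_le d _ 1) _; rewrite nderivn1 derivXsubC.
  by rewrite tofrac1 Defs.val1 add0r mulr1n.
apply: gauss0_ge => -[|[|i]]; rewrite /gterm coef_taylor.
- by rewrite nderivn0 mulr0n addr0 ge_min lexx.
- by rewrite nderivn1 derivXsubC tofrac1 Defs.val1 add0r mulr1n ge_min lexx orbT.
- by rewrite nderivn_poly0 ?size_XsubC // tofrac0 val0 le_topr.
Qed.

Lemma taylor_valC d b : taylor_val d b%:P = W (tofrac b%:P).
Proof.
apply/le_anti/andP; split; first exact: taylor_val_le0.
apply: gauss0_ge => -[|i]; rewrite /gterm coef_taylor.
  by rewrite nderivn0 mulr0n addr0.
by rewrite nderivn_poly0 ?tofrac0 ?val0 ?le_topr // size_polyC; case: (b != 0).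
Qed.

(** In the d-Gauss value of p(T + X) each root b contributes the minimum of d
    and the value of X - b, while in the value of the constant term p(X) it
    contributes the value of X - b; so a root of value greater than d makes the
    two differ. *)
Lemma taylor_val_root d p b : root p b ->
  taylor_val d p = W (tofrac p) -> p != 0 -> W (tofrac ('X - b%:P)) <= Fin d.
Proof.
move=> /factor_theorem [q ->] E pq0.
have q0 : W (tofrac q) != top.
  by rewrite val_neqtop tofrac_eq0; apply: contraNneq pq0 => ->; rewrite mul0r.
rewrite -(wt_leD2l _ _ q0) -Defs.valM -tofracM -E taylor_valM wt_leD //.
  exact: taylor_val_le0.
by rewrite taylor_val_lin ge_min lexx orbT.
Qed.

Lemma taylor_val_prod d (c : L) (s : seq L) :
  (forall b, b \in s -> W (tofrac ('X - b%:P)) <= Fin d) ->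
  taylor_val d (c *: \prod_(b <- s) ('X - b%:P)) =
    W (tofrac (c *: \prod_(b <- s) ('X - b%:P))).
Proof.
rewrite -mul_polyC; elim: s => [|b s IH] sd.
  by rewrite big_nil mulr1 taylor_valC.
rewrite big_cons mulrCA taylor_valM tofracM Defs.valM IH; last first.
  by move=> a sa; rewrite sd ?inE ?sa ?orbT.
by congr (_ + _); rewrite taylor_val_lin; apply/min_idPl/sd; rewrite inE eqxx.
Qed.

End Taylor.

Section Epsilon.
Variables (V : ordQVectType) (K : fieldType) (L : closedFieldType).
Variables (iota : {rmorphism K -> L}) (w : valuation V {fraction {poly K}}).
Variable wbar : valuation V {fraction {poly L}}.
Hypothesis wbar_w : extends (ratmap iota) w wbar.
Implicit Types (f g : {poly K}) (d : V) (b : L).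
Local Notation "p ^iota" := (map_poly iota p) (at level 2, format "p ^iota").

Lemma wbarE f : wbar (tofrac f^iota) = wpol w f.
Proof. by rewrite -ratmap_tofrac wbar_w. Qed.

(** Multiplying by b the bound on the term of index b of epsilon says that the
    coefficient of T ^ b in f(T + X) does not lower the d-Gauss value below the
    value of the constant term. *)
Lemma epsilon_le d f : (1 < size f)%N ->
  (epsilon w f <= Finb d) = (taylor_val wbar d f^iota == wbar (tofrac f^iota)).
Proof.
move=> f1; have fT : wpol w f != top.
  by rewrite val_neqtop tofrac_eq0 -size_poly_gt0 ltnW.
have termE (b : nat) : (0 < b)%N -> (eps_term w f b <= Finb d) =
    (wpol w f <= wpol w f^`N(b) + Fin (d *+ b)).
  move=> b0; rewrite /eps_term; case: eqVneq => [->|N0].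
    by rewrite /wpol tofrac0 val0 topadd le_topr.
  have NT : wpol w f^`N(b) != top by rewrite val_neqtop tofrac_eq0.
  rewrite -(finK fT) -(finK NT) FinD Fin_le /=.
  rewrite [_ <= _ :> withbot V]scale_invn_le //.
  apply/idP/idP => [/(ordq_leD _ _ (fin (wpol w f^`N(b))))|].
    by rewrite addrC subrK.
  by move=> /(ordq_leD _ _ (- fin (wpol w f^`N(b)))); rewrite addrC addKr.
apply/idP/eqP => [le_d|E]; last first.
  rewrite /epsilon big_seq; apply: bigmax_le => // b; rewrite mem_index_iota.
  case/andP=> b0 _; rewrite termE //.
  by rewrite -wbarE -E -(wbarE f^`N(b)) -nderivn_map taylor_val_le.
apply/le_anti; rewrite taylor_val_le0; apply: gauss0_ge => b.
rewrite /gterm coef_taylor nderivn_map !wbarE.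
case: b => [|b]; first by rewrite nderivn0 mulr0n addr0.
rewrite -termE //; have [bf|fb] := ltnP b.+1 (size f); last first.
  by rewrite /eps_term nderivn_poly0 ?eqxx.
apply: le_trans le_d; rewrite /epsilon big_nat.
by apply: (le_bigmax_seq bot); rewrite ?mem_index_iota.
Qed.

Lemma epsilon_neqbot f : (1 < size f)%N -> epsilon w f != bot.
Proof.
move=> f1; set n := (size f).-1.
have nf : (n < size f)%N by rewrite prednK ?(ltnW f1).
have n0 : (0 < n)%N by rewrite -ltnS prednK ?(ltnW f1).
have : eps_term w f n <= epsilon w f.
  rewrite /epsilon big_nat.
  by apply: (le_bigmax_seq bot); rewrite ?mem_index_iota ?n0 ?nf.
rewrite /eps_term ifN; first by case: (epsilon w f).
apply/eqP => /(congr1 (coefp 0)) /=; rewrite coef0 coef_nderivn addn0 binn mulr1n.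
by move/eqP; rewrite -lead_coefE lead_coef_eq0 -size_poly_eq0 -leqn0 leqNgt ltnW.
Qed.

(** By the slope criterion, the epsilon of a polynomial is the greatest value
    of X - b over its roots b; so a polynomial of degree less than that of a
    key polynomial has all its roots strictly farther from X than the
    optimizing root. *)
Lemma ABKP_root_lt Q alpha f b : ABKP w Q -> optimizing_root iota wbar Q alpha ->
  f != 0 -> (size f < size Q)%N -> root f^iota b ->
  wbar_lin wbar b < wbar_lin wbar alpha.
Proof.
move=> [Qmon Q1 Qmin] [Qalpha alpha_max] f0 fQ fb.
have f1 : (1 < size f)%N.
  by rewrite -(size_map_poly iota) (root_size_gt1 _ fb) ?map_poly_eq0.
rewrite ltNge; apply: contraTN fQ => ab; rewrite -leqNgt; apply: Qmin.
case E: (epsilon w f) (epsilon_neqbot f1) => [d|] // _.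
have b_le : wbar_lin wbar b <= Fin d.
  apply: (@taylor_val_root _ _ wbar d f^iota) => //; last by rewrite map_poly_eq0.
  by apply/eqP; rewrite -epsilon_le // E.
rewrite -/(Finb d) epsilon_le //.
have [s sE] := closed_field_poly_normal Q^iota.
rewrite sE taylor_val_prod // => c cs.
apply: le_trans b_le; apply: le_trans ab; apply: alpha_max.
by rewrite sE rootZ ?root_prod_XsubC // lead_coef_eq0 map_poly_eq0 monic_neq0.
Qed.

End Epsilon.
(** * Initial constants of rational functions near a point *)

Lemma invB_mul (F : fieldType) (x y : F) : x != 0 -> y != 0 ->
  (x^-1 - y^-1) * (x * y) = y - x.
Proof. by move=> x0 y0; rewrite mulrBl mulKf // mulrCA mulVf // mulr1. Qed.

Lemma invr_mulMr (F : fieldType) (x y : F) : y != 0 -> y^-1 * (x * y) = x.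
Proof. by move=> y0; rewrite mulrCA mulVf // mulr1. Qed.

Section Approx.
Variables (V : ordQVectType) (L : fieldType) (vbar : valuation V L).
Variable u : valuation V {fraction {poly L}}.
Hypothesis u_vbar : extends (@ratC L) vbar u.
Implicit Types (x y : {fraction {poly L}}) (a b c d : L) (p : {poly L}).

(** The constant c has the same initial form as x with respect to u; in
    particular x and c are nonzero. *)
Definition approx x c : Prop := vbar c < u (x - ratC c).

Lemma approx_val x c : approx x c -> u x = vbar c.
Proof.
rewrite /approx -u_vbar => xc; apply: (valB_eq (x := ratC c)).
by rewrite -[ratC c - x]opprB valN.
Qed.

Lemma approx_neq0 x c : approx x c -> c != 0.
Proof. by move/lt_neqtop; rewrite val_neqtop. Qed.

Lemma approx_const c : c != 0 -> approx (ratC c) c.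
Proof. by move=> c0; rewrite /approx subrr val0 neqtop_lt ?val_neqtop. Qed.

Lemma approxM x y c d : approx x c -> approx y d -> approx (x * y) (c * d).
Proof.
move=> xc yd; have cT := lt_neqtop xc; have dT := lt_neqtop yd.
rewrite /approx rmorphM /= Defs.valM.
have -> : x * y - ratC c * ratC d
          = (x - ratC c) * y + ratC c * (y - ratC d).
  by rewrite mulrBl mulrBr addrA subrK.
apply: val_gtD; rewrite Defs.valM.
  by rewrite (approx_val yd) wt_ltD2r.
by rewrite u_vbar wt_ltD2l.
Qed.

Lemma approxV x c : approx x c -> approx x^-1 c^-1.
Proof.
move=> xc; have c0 := approx_neq0 xc.
have x0 : x != 0 by rewrite -(val_neqtop u) (approx_val xc) (lt_neqtop xc).
have rc0 : ratC c != 0 by rewrite fmorph_eq0.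
rewrite /approx -u_vbar fmorphV /=.
have xcT : u (x * ratC c) != top.
  by rewrite val_neqtop; exact: (mulf_neq0 x0 rc0).
rewrite -(wt_ltD2r _ _ xcT) -!(Defs.valM u) (invr_mulMr x rc0) (invB_mul x0 rc0).
by rewrite (approx_val xc) -[ratC c - x]opprB valN.
Qed.

Lemma approxX x c n : approx x c -> approx (x ^+ n) (c ^+ n).
Proof.
move=> xc; elim: n => [|n IH]; last by rewrite !exprS; apply: approxM.
by rewrite !expr0 -(rmorph1 (@ratC L)); apply/approx_const/oner_neq0.
Qed.

Lemma approx_XsubC a b : vbar (a - b) < u (tofrac ('X - a%:P)) ->
  approx (tofrac ('X - b%:P)) (a - b).
Proof.
rewrite /approx /ratC -tofracB => lt_ab.
have -> // : 'X - b%:P - (a - b)%:P = 'X - a%:P.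
by rewrite polyCB opprB addrA subrK.
Qed.

Lemma approx_prod a c (s : seq L) : c != 0 ->
  (forall b, b \in s -> vbar (a - b) < u (tofrac ('X - a%:P))) ->
  approx (tofrac (c *: \prod_(b <- s) ('X - b%:P)))
         (c *: \prod_(b <- s) ('X - b%:P)).[a].
Proof.
move=> c0; rewrite -mul_polyC.
elim: s => [|b s IH] sa.
  by rewrite big_nil mulr1 hornerC; apply: approx_const.
rewrite big_cons mulrCA tofracM hornerM hornerXsubC; apply: approxM.
  by apply: approx_XsubC; rewrite sa ?inE ?eqxx.
by apply: IH => d sd; rewrite sa ?inE ?sd ?orbT.
Qed.

End Approx.

Section Gauss.
Variables (V : ordQVectType) (L : fieldType) (vbar : valuation V L).
Variables (a : L) (d : V).
Local Notation u := (gauss vbar a d).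
Implicit Types (b c : L) (p : {poly L}).

Lemma gauss_le p i : u (tofrac p) <= vbar p^`N(i).[a] + Fin (d *+ i).
Proof.
rewrite fracval_tofrac; apply: le_trans (gauss0_le _ _ _ i) _.
by rewrite /gterm coef_comp_XaddC.
Qed.

Lemma gauss_le_horner p : u (tofrac p) <= vbar p.[a].
Proof. by have := gauss_le p 0; rewrite nderivn0 mulr0n addr0. Qed.

Lemma gauss_ge p g :
  (forall i, g <= vbar p^`N(i).[a] + Fin (d *+ i)) -> g <= u (tofrac p).
Proof.
move=> gp; rewrite fracval_tofrac; apply: gauss0_ge => i.
by rewrite /gterm coef_comp_XaddC.
Qed.

Lemma gauss_extends : extends (@ratC L) vbar u.
Proof.
move=> c; apply/le_anti/andP; split.
  by have := gauss_le_horner c%:P; rewrite hornerC.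
apply: gauss_ge => -[|i]; first by rewrite nderivn0 hornerC mulr0n addr0.
rewrite nderivn_poly0 ?horner0 ?val0 ?topadd ?le_topr //.
by rewrite size_polyC; case: (c != 0).
Qed.

Lemma gauss_XsubC b : u (tofrac ('X - b%:P)) = Order.min (vbar (a - b)) (Fin d).
Proof.
apply/le_anti/andP; split.
  rewrite le_min; have := gauss_le_horner ('X - b%:P).
  rewrite hornerXsubC => -> /=; have := gauss_le ('X - b%:P) 1.
  by rewrite nderivn1 derivXsubC hornerE Defs.val1 add0r mulr1n.
apply: gauss_ge => -[|[|i]].
- by rewrite nderivn0 hornerXsubC mulr0n addr0 ge_min lexx.
- by rewrite nderivn1 derivXsubC hornerE Defs.val1 add0r mulr1n ge_min lexx orbT.
- by rewrite nderivn_poly0 ?size_XsubC // horner0 val0 le_topr.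
Qed.

End Gauss.

(** * The truncation as a Gauss valuation *)

Section Truncation.
Variables (V : ordQVectType) (K : fieldType).
Variables (Kbar : closedFieldType) (iota : {rmorphism K -> Kbar}).
Variables (vbar : valuation V Kbar) (w : valuation V {fraction {poly K}}).
Variable wbar : valuation V {fraction {poly Kbar}}.
Hypotheses (wbar_w : extends (ratmap iota) w wbar).
Hypothesis wbar_vbar : extends (@ratC Kbar) vbar wbar.
Variables (Q : {poly K}) (alpha : Kbar).
Hypotheses (Q_ABKP : ABKP w Q) (alpha_opt : optimizing_root iota wbar Q alpha).
(** What is used of the Gauss valuation centred at the optimizing root, of
    radius the value of X - alpha. *)
Variable u : valuation V {fraction {poly Kbar}}.
Hypothesis u_vbar : extends (@ratC Kbar) vbar u.
Hypothesis u_XsubC : forall b, u (tofrac ('X - b%:P)) =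
  Order.min (vbar (alpha - b)) (wbar_lin wbar alpha).
Hypothesis u_le_horner : forall p, u (tofrac p) <= vbar p.[alpha].

Implicit Types (f g r F : {poly K}).

Local Notation "p ^iota" := (map_poly iota p) (at level 2, format "p ^iota").
Local Notation theta f := (tofrac f^iota).
Local Notation W f := (u (theta f)).
Local Notation n := (size Q).-1.

Lemma Q_monic : Q \is monic. Proof. by case: Q_ABKP. Qed.
Lemma size_Q_gt1 : (1 < size Q)%N. Proof. by case: Q_ABKP. Qed.
Lemma Q_neq0 : Q != 0. Proof. exact: monic_neq0 Q_monic. Qed.
Lemma Q_alpha : Q^iota.[alpha] = 0. Proof. by case: alpha_opt => /rootP. Qed.

Lemma u_alpha : u (tofrac ('X - alpha%:P)) = wbar_lin wbar alpha.
Proof. by rewrite u_XsubC subrr val0; apply/min_idPr/le_topr. Qed.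

Lemma wpolM f g : wpol w (f * g) = wpol w f + wpol w g.
Proof. by rewrite /wpol tofracM Defs.valM. Qed.

Lemma theta_eq0 f : (theta f == 0) = (f == 0).
Proof. by rewrite tofrac_eq0 map_poly_eq0. Qed.

Lemma W_neqtop f : (W f != top) = (f != 0).
Proof. by rewrite val_neqtop theta_eq0. Qed.

Lemma thetaM f g : theta (f * g) = theta f * theta g.
Proof. by rewrite rmorphM tofracM. Qed.

Lemma thetaB f g : theta (f - g) = theta f - theta g.
Proof. by rewrite rmorphB tofracB. Qed.

Lemma thetaX f k : theta (f ^+ k) = theta f ^+ k.
Proof. by rewrite rmorphXn /= tofracXn. Qed.

Lemma WM f g : W (f * g) = W f + W g.
Proof. by rewrite thetaM Defs.valM. Qed.

Lemma theta_sum (I : Type) (s : seq I) (P : pred I) (G : I -> {poly K}) :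
  theta (\sum_(i <- s | P i) G i) = \sum_(i <- s | P i) theta (G i).
Proof. by rewrite !rmorph_sum. Qed.

(** The roots of a polynomial of degree less than n are farther from X than
    alpha is, so each factor X - b can be replaced by alpha - b. *)
Lemma approx_small (u' : valuation V {fraction {poly Kbar}}) r :
  extends (@ratC Kbar) vbar u' ->
  u' (tofrac ('X - alpha%:P)) = wbar_lin wbar alpha ->
  r != 0 -> (size r < size Q)%N -> approx vbar u' (theta r) r^iota.[alpha].
Proof.
move=> u'_vbar u'_alpha r0 rQ; have [s sE] := closed_field_poly_normal r^iota.
rewrite sE; apply: approx_prod => // [|b bs].
  by rewrite lead_coef_eq0 map_poly_eq0.
have rb : root r^iota b.
  by rewrite sE rootZ ?root_prod_XsubC // lead_coef_eq0 map_poly_eq0.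
have ltb := ABKP_root_lt wbar_w Q_ABKP alpha_opt r0 rQ rb.
rewrite u'_alpha -wbar_vbar /ratC.
have -> : (alpha - b)%:P = ('X - b%:P) - ('X - alpha%:P).
  by rewrite polyCB opprB [RHS]addrC addrA subrK.
by rewrite tofracB val_addl // valN.
Qed.

Lemma approx_u r : r != 0 -> (size r < size Q)%N ->
  approx vbar u (theta r) r^iota.[alpha].
Proof. exact: (approx_small u_vbar u_alpha). Qed.

Lemma W_small r : (size r < size Q)%N -> W r = vbar r^iota.[alpha].
Proof.
move=> rQ; have [->|r0] := eqVneq r 0; first by rewrite rmorph0 horner0 !val0.
by apply: (approx_val u_vbar); apply: approx_u.
Qed.

Lemma W_small_wpol r : (size r < size Q)%N -> W r = wpol w r.
Proof.
move=> rQ; rewrite -(wbarE wbar_w); have [->|r0] := eqVneq r 0.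
  by rewrite rmorph0 tofrac0 !val0.
rewrite W_small //; apply/esym/(approx_val wbar_vbar).
exact: approx_small.
Qed.

Lemma horner_small_neq0 r : r != 0 -> (size r < size Q)%N ->
  r^iota.[alpha] != 0.
Proof. by move=> r0 rQ; apply: approx_neq0 (approx_u r0 rQ). Qed.

(** Root by root: the values of X - b under w and under W agree because that
    of X - alpha is the greatest over the roots of Q. *)
Lemma W_Q : W Q = wpol w Q.
Proof.
rewrite -(wbarE wbar_w); have [s sE] := closed_field_poly_normal Q^iota.
have s_le b : b \in s -> wbar_lin wbar b <= wbar_lin wbar alpha.
  move=> bs; case: alpha_opt => _; apply.
  by rewrite sE rootZ ?root_prod_XsubC // lead_coef_eq0 map_poly_eq0 Q_neq0.
rewrite sE -mul_polyC !tofracM !Defs.valM -/(ratC _) u_vbar wbar_vbar.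
congr (_ + _).
elim: s s_le {sE} => [|b s IH] s_le; first by rewrite big_nil !tofrac1 !Defs.val1.
rewrite big_cons !tofracM !Defs.valM IH => [|c cs]; last first.
  by rewrite s_le // inE cs orbT.
congr (_ + _); have {s_le} := s_le b (mem_head _ _).
rewrite u_XsubC -wbar_vbar /wbar_lin.
set xb := tofrac ('X - b%:P); set xa := tofrac ('X - alpha%:P) => le_ba.
have E : ratC (alpha - b) = xb - xa.
  rewrite /xa /xb /ratC -tofracB; congr tofrac.
  by rewrite polyCB opprB [RHS]addrC addrA subrK.
have [lt_ba|ge_ba] := ltP (wbar xb) (wbar xa).
  by rewrite E val_addl ?valN //; apply/min_idPl/ltW.
have -> : wbar xb = wbar xa by apply/le_anti; rewrite le_ba.
by apply/min_idPr; rewrite E val_geB.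
Qed.

(** W is at most the value at alpha, where f and its remainder modulo Q agree;
    and on the remainder, of small degree, this bound is an equality. *)
Lemma W_le_modp f : W f <= W (f %% Q).
Proof.
rewrite (@W_small (f %% Q)) ?ltn_modp ?Q_neq0 //.
apply: le_trans (u_le_horner _) _.
by rewrite {1}(divp_eq f Q) rmorphD rmorphM /= !hornerE Q_alpha mulr0 add0r.
Qed.

Lemma W_le_divX f i : W f <= W (f %/ Q ^+ i * Q ^+ i).
Proof.
elim: i => [|i IH]; first by rewrite expr0 divp1 mulr1.
apply: le_trans IH _; set g := f %/ Q ^+ i.
have -> : f %/ Q ^+ i.+1 * Q ^+ i.+1 = (g - g %% Q) * Q ^+ i.
  by rewrite {1}(divp_eq g Q) addrK exprSr -divp_divl mulrA mulrAC.
rewrite !WM; apply: wt_leD (lexx _); rewrite thetaB.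
by apply: val_geB; [exact: lexx | exact: W_le_modp].
Qed.

Lemma W_le_term f i : W f <= W (qcoef Q f i * Q ^+ i).
Proof.
apply: le_trans (W_le_divX f i) _; rewrite !WM.
exact: wt_leD (W_le_modp _) (lexx _).
Qed.

Lemma W_term r i : (size r < size Q)%N -> W (r * Q ^+ i) = wpol w (r * Q ^+ i).
Proof.
move=> rQ; rewrite WM W_small_wpol // thetaX valX W_Q.
by rewrite wpolM [in RHS]/wpol tofracXn valX.
Qed.

(** Both sides are the minimum of the values of the terms of the Q-expansion:
    these terms cannot cancel for W, by W_le_term. *)
Lemma truncE f : trunc w Q f = W f.
Proof.
have termE i : wpol w (qcoef Q f i * Q ^+ i) = W (qcoef Q f i * Q ^+ i).
  by rewrite W_term // size_qcoef // size_Q_gt1.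
apply/le_anti/andP; split; last first.
  apply/bigmin_geP; split=> [|i _]; first exact: le_topr.
  by rewrite termE W_le_term.
rewrite {2}(qcoef_sum f size_Q_gt1) theta_sum; apply: val_le_sum => i _.
by rewrite -termE; apply: (bigmin_le _ i).
Qed.

Lemma W_le_wpol f : W f <= wpol w f.
Proof.
rewrite [X in _ <= wpol w X](qcoef_sum f size_Q_gt1) /wpol rmorph_sum.
apply: val_le_sum => i _; rewrite -/(wpol w _) -W_term ?W_le_term //.
by rewrite size_qcoef // size_Q_gt1.
Qed.

(** * Residues of Q-expansions *)

Lemma W_QX i : W (Q ^+ i) = W Q *+ i.
Proof. by rewrite thetaX valX. Qed.

Lemma gamma_neqtop i : W Q *+ i != top.
Proof. by apply: mulrn_neqtop; rewrite W_neqtop Q_neq0. Qed.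

Lemma size_QX i : size (Q ^+ i) = (n * i).+1.
Proof.
by rewrite -size_exp prednK // lt0n size_poly_eq0 expf_neq0 // Q_neq0.
Qed.

Lemma n_gt0 : (0 < n)%N.
Proof. by rewrite -ltnS prednK ?size_Q_gt1 // ltnW // size_Q_gt1. Qed.

Lemma size_smallE r : (size r < size Q)%N = (size r <= n)%N.
Proof. by rewrite -[in RHS]ltnS prednK // ltnW // size_Q_gt1. Qed.

Lemma monic_divQX F i : F \is monic -> size F = (n * i).+1 -> F %/ Q ^+ i = 1.
Proof.
move=> Fmon sF; have -> : F = 1 * Q ^+ i + (F - Q ^+ i).
  by rewrite mul1r addrC subrK.
apply: divp_addl_mul_small; rewrite size_QX ltnS; apply/leq_sizeP => j.
rewrite coefB leq_eqVlt => /predU1P[<-|lt_j].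
  have := monicP Fmon; have := monicP (monic_exp i Q_monic).
  by rewrite /lead_coef size_QX sF /= => -> ->; rewrite subrr.
by rewrite !nth_default ?subr0 ?size_QX ?sF.
Qed.

(** Q is irreducible, since its proper factors do not vanish at alpha. *)
Lemma coprimep_small r : r != 0 -> (size r < size Q)%N -> coprimep r Q.
Proof.
move=> r0 rQ; set d := gcdp r Q; have d0 : d != 0 by rewrite gcdp_eq0 (negPf r0).
have dr : (size d <= size r)%N by apply: dvdp_leq; rewrite ?dvdp_gcdl.
have [q Qd] := dvdpP _ _ (dvdp_gcdr r Q : d %| Q).
have q0 : q != 0 by apply: contraNneq Q_neq0 => q0; rewrite Qd q0 mul0r.
apply: contraT => d1.
have d2 : (1 < size d)%N by rewrite ltn_neqAle eq_sym d1 size_poly_gt0.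
have dQ : (size q < size Q)%N.
  rewrite Qd size_mul //; case: (size d) d2 => [|[|k]] // _.
  by rewrite !addnS /= ltnS leq_addr.
have := Q_alpha; rewrite Qd rmorphM hornerM => /eqP; rewrite mulf_eq0.
rewrite (negPf (horner_small_neq0 q0 dQ)).
by rewrite (negPf (horner_small_neq0 d0 (leq_ltn_trans dr rQ))).
Qed.

Lemma inverse_mod r : r != 0 -> (size r < size Q)%N ->
  exists g, [/\ g != 0, (size g < size Q)%N & (g * r) %% Q = 1].
Proof.
move=> r0 rQ; have /Bezout_eq1_coprimepP [[a b] /= ab] := coprimep_small r0 rQ.
have E : ((a %% Q) * r) %% Q = 1.
  rewrite mulrC modp_mul mulrC.
  have -> : a * r = 1 - b * Q by rewrite -ab addrK.
  rewrite modpD modpN modp_mull oppr0 addr0 modp_small //.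
  by rewrite size_poly1 size_Q_gt1.
exists (a %% Q); split; rewrite ?ltn_modp ?Q_neq0 //.
by apply: contra_eq_neq E => ->; rewrite mul0r mod0p eq_sym oner_neq0.
Qed.

(** Both the product and its remainder have the same initial constant, their
    common value at alpha. *)
Lemma W_mod_lt f g : f != 0 -> g != 0 -> (size f < size Q)%N ->
  (size g < size Q)%N -> W f + W g < W (f * g %/ Q * Q).
Proof.
move=> f0 g0 fQ gQ; set r := f * g %% Q.
have rQ : (size r < size Q)%N by rewrite ltn_modp Q_neq0.
have -> : f * g %/ Q * Q = f * g - r by rewrite {2}(divp_eq (f * g) Q) addrK.
have af := approx_u f0 fQ; have ag := approx_u g0 gQ.
have afg := approxM u_vbar af ag; set c := (X in approx _ _ _ X) in afg.
have rE : r^iota.[alpha] = c.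
  rewrite /c -hornerM -rmorphM {1}(divp_eq (f * g) Q) rmorphD rmorphM /=.
  by rewrite hornerD hornerM Q_alpha mulr0 add0r.
have r0 : r != 0.
  apply: contraNneq (approx_neq0 afg) => r0.
  by rewrite -rE r0 rmorph0 horner0.
have ar := approx_u r0 rQ; rewrite rE in ar.
rewrite -WM thetaM (approx_val u_vbar afg) thetaB thetaM.
have -> : theta f * theta g - theta r
  = (theta f * theta g - ratC c) - (theta r - ratC c).
  by rewrite opprB addrA subrK.
exact: val_gtB.
Qed.

Local Notation Ka := (Kalpha iota Q alpha).
Local Notation kin := (Kalpha_inj iota Q alpha).
Local Notation v1a := (v1 iota vbar Q alpha).

Definition eval_alpha f : Ka := subfx_eval iota alpha Q f.

Lemma kin_eval f : kin (eval_alpha f) = f^iota.[alpha].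
Proof. by apply: subfx_inj_eval; [apply/rootP/Q_alpha | exact: Q_neq0]. Qed.

Lemma eval_alpha_repr (x : Ka) :
  exists r, (size r < size Q)%N && (kin x == r^iota.[alpha]).
Proof.
have [f ->] := subfxE x; exists (f %% Q); rewrite ltn_modp Q_neq0 /=.
rewrite -/(eval_alpha f) kin_eval {1}(divp_eq f Q) rmorphD rmorphM /=.
by rewrite hornerD hornerM Q_alpha mulr0 add0r.
Qed.

(** Elements of K(alpha) are the values at alpha of polynomials of degree less
    than n, so their value and residue can be read in K[X]. *)
Definition small_repr (x : Ka) : {poly K} := xchoose (eval_alpha_repr x).

Lemma size_small_repr x : (size (small_repr x) < size Q)%N.
Proof. by have /andP[] := xchooseP (eval_alpha_repr x). Qed.

Lemma small_reprE x : (small_repr x)^iota.[alpha] = kin x.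
Proof. by have /andP[_ /eqP] := xchooseP (eval_alpha_repr x). Qed.

Lemma eval_alpha_eq0 r : (size r < size Q)%N -> (eval_alpha r == 0) = (r == 0).
Proof.
move=> rQ; rewrite -(fmorph_eq0 kin) kin_eval.
have [->|r0] := eqVneq r 0; first by rewrite rmorph0 horner0 eqxx.
by apply/negbTE/horner_small_neq0.
Qed.

Lemma small_repr1 : small_repr 1 = 1.
Proof.
have Q1 := size_Q_gt1.
apply/eqP; rewrite -subr_eq0 -eval_alpha_eq0; last first.
  apply: leq_ltn_trans (size_polyD _ _) _.
  by rewrite gtn_max size_small_repr size_polyN size_poly1.
rewrite -(fmorph_eq0 kin) kin_eval rmorphB rmorph1 hornerD hornerN.
by rewrite small_reprE rmorph1 hornerC subrr.
Qed.

Lemma v1_eval r : (size r < size Q)%N -> v1a (eval_alpha r) = W r.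
Proof. by move=> rQ; rewrite W_small //= kin_eval. Qed.

Lemma v1_small_repr x : W (small_repr x) = v1a x.
Proof. by rewrite W_small ?size_small_repr // small_reprE. Qed.

(** Written with an explicit abstraction, so as to be convertible with kv1_emb
    when u is the Gauss valuation. *)
Definition emb : resfield v1a -> resfield u :=
  resmap (fun x => ratC (kin x)) v1a u.

Lemma ratC_kin_extends : extends (@ratC Kbar \o kin) v1a u.
Proof. by move=> x; rewrite /= u_vbar. Qed.

Definition emb_rmorphism : {rmorphism resfield v1a -> resfield u} :=
  resmap_rmorphism ratC_kin_extends.

Lemma emb_res x : (0 : withtop V) <= v1a x ->
  emb (res v1a x) = res u (ratC (kin x)).
Proof. exact: (resmap_res ratC_kin_extends). Qed.

Variables (e : nat) (h : {poly K}).
Hypotheses (e_gt0 : (0 < e)%N) (h_small : (size h < size Q)%N).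
Hypothesis W_h : W h = W Q *+ e.

Lemma h_neq0 : h != 0.
Proof. by rewrite -W_neqtop W_h gamma_neqtop. Qed.

Lemma theta_h_neq0 k : theta h ^+ k != 0.
Proof. by rewrite expf_neq0 // theta_eq0 h_neq0. Qed.

Lemma W_hX k : u (theta h ^+ k) = W Q *+ (e * k).
Proof. by rewrite valX W_h mulrnA. Qed.

Lemma eval_h_neq0 k : eval_alpha h ^+ k != 0.
Proof. by rewrite expf_neq0 // eval_alpha_eq0 // h_neq0. Qed.

Lemma v1_hX k : v1a (eval_alpha h ^+ k) = W Q *+ (e * k).
Proof. by rewrite valX v1_eval // W_h mulrnA. Qed.

(** r / h ^ k has the same initial form as the constant r(alpha) /
    h(alpha) ^ k. *)
Lemma res_coef r k : (size r < size Q)%N -> W Q *+ (e * k) <= W r ->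
  res u (theta r / theta h ^+ k)
    = emb (res v1a (eval_alpha r / eval_alpha h ^+ k)).
Proof.
move=> rQ le_r; set x := eval_alpha r / _.
have x_ge0 : (0 : withtop V) <= v1a x.
  by rewrite le_val_div ?eval_h_neq0 // add0r v1_hX v1_eval.
rewrite emb_res //; have [r0|r0] := eqVneq r 0.
  have -> : x = 0.
    have /eqP r1 : eval_alpha r == 0 by rewrite eval_alpha_eq0 // r0.
    by rewrite /x r1 mul0r.
  by rewrite r0 !rmorph0 mul0r.
have ah := approxV u_vbar (approxX u_vbar k (approx_u h_neq0 h_small)).
have := approxM u_vbar (approx_u r0 rQ) ah.
set y := _ * _; set c := (X in approx _ _ _ X) => yc.
have cE : c = kin x.
  by rewrite /x rmorphM fmorphV rmorphXn /= !kin_eval.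
rewrite cE in yc; have x_ge0' : (0 : withtop V) <= vbar (kin x) by [].
apply/eqP; rewrite res_eq ?u_vbar ?(approx_val u_vbar yc) //.
exact: le_lt_trans yc.
Qed.
Local Notation Y := (res u (theta Q ^+ e / theta h)).

Lemma u_Qe_div_h : u (theta Q ^+ e / theta h) = 0.
Proof.
apply: val_div; first by rewrite theta_eq0 h_neq0.
by rewrite add0r valX W_h.
Qed.

Lemma res_term r j k : (size r < size Q)%N -> W Q *+ (e * k) <= W r ->
  (0 : withtop V) <= u (theta (r * Q ^+ (e * j)) / theta h ^+ (k + j)) /\
  res u (theta (r * Q ^+ (e * j)) / theta h ^+ (k + j)) =
    emb (res v1a (eval_alpha r / eval_alpha h ^+ k)) * Y ^+ j.
Proof.
move=> rQ le_r.
have -> : theta (r * Q ^+ (e * j)) / theta h ^+ (k + j) =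
    (theta r / theta h ^+ k) * (theta Q ^+ e / theta h) ^+ j.
  by rewrite thetaM thetaX exprM; apply: div_exprD.
have ge0 : (0 : withtop V) <= u (theta r / theta h ^+ k).
  by rewrite le_val_div ?theta_h_neq0 // add0r W_hX.
have Y0 : (0 : withtop V) <= u (theta Q ^+ e / theta h).
  by rewrite u_Qe_div_h lexx.
have Yj0 : (0 : withtop V) <= u ((theta Q ^+ e / theta h) ^+ j).
  by rewrite valX u_Qe_div_h mul0rn.
split; first by rewrite Defs.valM -[0]addr0 wt_leD.
by rewrite (resM ge0 Yj0) (resX _ Y0) res_coef.
Qed.

Lemma res_expansion m (r : nat -> {poly K}) :
  (forall j, (j <= m)%N -> (size (r j) < size Q)%N) ->
  (forall j, (j <= m)%N -> W Q *+ (e * (m - j)) <= W (r j)) ->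
  (0 : withtop V) <=
    u (theta (\sum_(j < m.+1) r j * Q ^+ (e * j)) / theta h ^+ m) /\
  res u (theta (\sum_(j < m.+1) r j * Q ^+ (e * j)) / theta h ^+ m) =
  (map_poly emb (\poly_(j < m.+1)
     res v1a (eval_alpha (r j) / eval_alpha h ^+ (m - j)))).[Y].
Proof.
move=> rQ le_r.
have -> : theta (\sum_(j < m.+1) r j * Q ^+ (e * j)) / theta h ^+ m =
    \sum_(j < m.+1) theta (r j * Q ^+ (e * j)) / theta h ^+ (m - j + j).
  rewrite theta_sum big_distrl /=; apply: eq_bigr => j _.
  by rewrite subnK // -ltnS.
have term (j : 'I_m.+1) :=
  @res_term (r j) j (m - j) (rQ j (ltn_ord j)) (le_r j (ltn_ord j)).
split; first by apply: val_le_sum => j _; case: (term j).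
rewrite res_sum => [|j _]; last by case: (term j).
have -> : map_poly emb (\poly_(j < m.+1)
     res v1a (eval_alpha (r j) / eval_alpha h ^+ (m - j))) =
   \poly_(j < m.+1) emb (res v1a (eval_alpha (r j) / eval_alpha h ^+ (m - j))).
  apply/polyP => j; rewrite (coef_map emb_rmorphism) !coef_poly /=.
  by case: ifP => // _; apply: (rmorph0 emb_rmorphism).
by rewrite horner_poly; apply: eq_bigr => j _; case: (term j).
Qed.

Lemma size_mulQX_le r i k : (size r < size Q)%N -> (i < k)%N ->
  (size (r * Q ^+ i)%R <= n * k)%N.
Proof.
rewrite size_smallE => rn ik.
apply: leq_trans (size_polyMleq _ _) _; rewrite size_QX addnS /=.
by apply: leq_trans (leq_add rn (leqnn _)) _; rewrite -mulnS leq_mul.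
Qed.

Lemma size_sum_le (I : finType) (P : pred I) (G : I -> {poly K}) k :
  (forall i, P i -> (size (G i) <= k)%N) ->
  (size (\sum_(i | P i) G i)%R <= k)%N.
Proof.
by move=> Gk; apply: leq_trans (size_sum _ _ _) _; apply/bigmax_leqP.
Qed.

(** The relation of being a lifting, in terms of W instead of the truncation,
    and with the value of h ^ m substituted. *)
Definition lifts F (G : {poly resfield v1a}) : Prop :=
  let m := (size G).-1 in
  [/\ F \is monic, G \is monic & (0 < m)%N] /\
  [/\ (size F).-1 = (e * m * n)%N, W F = W Q *+ (e * m)
    & res u (theta F / theta h ^+ m) = (map_poly emb G).[Y]].

(** This turns equalities of residues into estimates for W, hence for w. *)
Lemma res_eq_close f g m : W Q *+ (e * m) <= W f -> W Q *+ (e * m) <= W g ->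
  (res u (theta f / theta h ^+ m) == res u (theta g / theta h ^+ m)) =
  (W Q *+ (e * m) < W (f - g)).
Proof.
move=> le_f le_g.
rewrite res_eq ?le_val_div ?theta_h_neq0 ?add0r ?W_hX //.
have -> : theta f / theta h ^+ m - theta g / theta h ^+ m =
    theta (f - g) / theta h ^+ m by rewrite thetaB [RHS]mulrBl.
by rewrite lt_val_div ?theta_h_neq0 // add0r W_hX.
Qed.

(** Each coefficient c_j of G is lifted to the small representative of
    c_j h(alpha) ^ (d - j), which is then the coefficient of Q ^ (e j). *)
Lemma lifts_exists (G : {poly resfield v1a}) : G \is monic ->
  (1 < size G)%N -> exists F, lifts F G.
Proof.
move=> Gmon; have [d Gd] : exists d, (size G).-1 = d by exists (size G).-1.
have G0 : (0 < size G)%N by rewrite size_poly_gt0 monic_neq0.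
have sG : size G = d.+1 by rewrite -Gd prednK.
rewrite sG ltnS => d0.
(* The leading coefficient is lifted to 1 itself, so that F is monic. *)
pose c (j : nat) : Ka := if j == d then 1 else lift_res G`_j.
have c_ge0 j : (0 : withtop V) <= v1a (c j).
  by rewrite /c; case: ifP => _; rewrite ?lift_res_ge0 // Defs.val1.
pose r j := small_repr (c j * eval_alpha h ^+ (d - j)).
have rd : r d = 1 by rewrite /r /c eqxx subnn expr0 mulr1 small_repr1.
have rQ j : (size (r j) < size Q)%N by apply: size_small_repr.
have W_r j : W Q *+ (e * (d - j)) <= W (r j).
  by rewrite v1_small_repr Defs.valM v1_hX -[X in X <= _]add0r wt_leD.
pose F := \sum_(j < d.+1) r j * Q ^+ (e * j).
have FE : F = \sum_(j < d) r j * Q ^+ (e * j) + Q ^+ (e * d).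
  by rewrite /F big_ord_recr /= rd mul1r.
have lowF : (size (\sum_(j < d) r j * Q ^+ (e * j))%R
               < size (Q ^+ (e * d)%N)%R)%N.
  rewrite size_QX ltnS; apply: size_sum_le => j _.
  by apply: size_mulQX_le => //; rewrite ltn_pmul2l.
have Fmon : F \is monic.
  by rewrite monicE FE lead_coefDr // -monicE monic_exp // Q_monic.
have sF : size F = (n * (e * d)).+1 by rewrite FE addrC size_polyDl // size_QX.
have [ge0 resF] := @res_expansion d r (fun j _ => rQ j) (fun j _ => W_r j).
have leF : W Q *+ (e * d) <= W F.
  by move: ge0; rewrite le_val_div ?theta_h_neq0 // add0r W_hX.
exists F; split; rewrite Gd //; split.
- by rewrite sF /= mulnC.
- apply/le_anti; rewrite leF andbT -W_QX.
  by have := W_le_divX F (e * d); rewrite monic_divQX // mul1r.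
rewrite resF; congr (map_poly emb _).[_]; apply/polyP => j.
rewrite coef_poly; case: ltnP => [jd|dj]; last first.
  by rewrite nth_default // sG.
have -> : eval_alpha (r j) / eval_alpha h ^+ (d - j) = c j.
  apply: (fmorph_inj kin); rewrite fmorph_div kin_eval small_reprE.
  by rewrite rmorphM mulfK // fmorph_eq0 eval_h_neq0.
rewrite /c; case: eqVneq => [->|_]; last by rewrite res_lift.
by rewrite res1; have := monicP Gmon; rewrite /lead_coef Gd.
Qed.

Lemma map_emb_M (G1 G2 : {poly resfield v1a}) :
  map_poly emb (G1 * G2) = map_poly emb G1 * map_poly emb G2.
Proof. exact: (rmorphM (map_poly emb_rmorphism)). Qed.

Hypothesis e_min : forall e', (0 < e')%N ->
  in_value_group v1a (W Q *+ e') -> (e <= e')%N.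

(** The integers i with i gamma in the value group of K(alpha) form an ideal of
    which e is the least positive element. *)
Lemma ramif_dvd i : in_value_group v1a (W Q *+ i) -> (e %| i)%N.
Proof.
case=> x x0 vx; apply: contraTT isT; rewrite /dvdn -lt0n => r0.
have /(e_min r0) : in_value_group v1a (W Q *+ (i %% e)).
  exists (x / eval_alpha h ^+ (i %/ e)).
    by rewrite mulf_neq0 ?invr_eq0 ?eval_h_neq0.
  apply: val_div; first exact: eval_h_neq0.
  by rewrite vx v1_hX -mulrnDr addnC mulnC -divn_eq.
by rewrite leqNgt ltn_mod e_gt0.
Qed.

Lemma sum_dvd_ord (U : zmodType) m (G : nat -> U) :
  \sum_(i < (e * m).+1 | (e %| i)%N) G i = \sum_(j < m.+1) G (e * j)%N.
Proof.
elim: m => [|m IH].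
  by rewrite muln0 big_mkcond !big_ord_recl !big_ord0 /= dvdn0 muln0.
rewrite [RHS]big_ord_recr /= -IH -!(big_mkord (fun i => (e %| i)%N)).
rewrite (@big_cat_nat _ _ _ (e * m).+1) //=; last first.
  by rewrite ltnS leq_mul2l leqnSn orbT.
congr (_ + _); rewrite big_mkcond big_nat_recr /=; last by rewrite ltn_pmul2l.
rewrite dvdn_mulr // big_nat_cond big1 ?add0r // => i /andP[/andP[lt_i i_lt] _].
case: ifP => // /dvdnP[q iE]; move: lt_i i_lt.
by rewrite iE (mulnC q) !ltn_pmul2l // ltnS => mq; rewrite leqNgt mq.
Qed.

(** * Polynomials of least degree on which the truncation differs from w *)

(** Membership in psi(Q), in terms of W. *)
Definition minimal F : Prop :=
  [/\ F \is monic, W F < wpol w F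
    & forall f, W f < wpol w f -> ((size F).-1 <= (size f).-1)%N].

Section Minimal.
Variable F : {poly K}.
Hypothesis F_minimal : minimal F.
Local Notation Fi i := (qcoef Q F i).

Let Fmon : F \is monic. Proof. by case: F_minimal. Qed.

Let F_lt : W F < wpol w F. Proof. by case: F_minimal. Qed.

Let F_min f : W f < wpol w f -> ((size F).-1 <= (size f).-1)%N.
Proof. by case: F_minimal => _ _; apply. Qed.

Let F_neq0 : F != 0. Proof. exact: monic_neq0. Qed.

Let F_neqtop : W F != top. Proof. by rewrite W_neqtop. Qed.

Let size_F_gt : ~~ (size F < size Q)%N.
Proof. by apply: contraL F_lt => FQ; rewrite W_small_wpol // ltxx. Qed.

Lemma minimal_small f : ((size f).-1 < (size F).-1)%N -> W f = wpol w f.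
Proof.
move=> fF; apply/le_anti; rewrite W_le_wpol /= leNgt.
by apply: contraL fF => /F_min; rewrite -leqNgt.
Qed.

(** Otherwise F %/ Q would be a smaller polynomial on which the truncation
    differs from w. *)
Lemma W_coef0 : W (Fi 0) = W F.
Proof.
have E : Fi 0 = F %% Q by rewrite /qcoef expr0 divp1.
rewrite E; apply/le_anti; rewrite W_le_modp andbT leNgt; apply/negP => lt0.
have rQ : (size (F %% Q)%R < size Q)%N by rewrite ltn_modp Q_neq0.
have FQ : F %/ Q * Q = F - F %% Q by rewrite {2}(divp_eq F Q) addrK.
have W_FQ : W (F %/ Q * Q) = W F by rewrite FQ thetaB val_addl // valN.
have w_FQ : W F < wpol w (F %/ Q * Q).
  rewrite FQ /wpol tofracB; apply: val_gtB => //.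
  by rewrite -/(wpol w _) -W_small_wpol.
have : W (F %/ Q) < wpol w (F %/ Q).
  move: w_FQ; rewrite -W_FQ WM wpolM -W_Q wt_ltD2r //.
  by rewrite W_neqtop Q_neq0.
move/F_min; rewrite size_divp ?Q_neq0 // leqNgt => /negP; apply.
have := size_F_gt; rewrite -leqNgt => QF; have := size_Q_gt1.
case: (size Q) QF => [|[|k]] // kF _ /=; rewrite -subn1 -subnDA ltn_predRL.
by rewrite addn1 -subSn // subSS ltn_subrL /= (leq_trans _ kF).
Qed.

(** Since F_0 is dominant too, i gamma is the difference of the values of
    F_0(alpha) and F_i(alpha). *)
Lemma term_dvd i : W (Fi i * Q ^+ i) = W F -> (e %| i)%N.
Proof.
move=> Wi; have Q1 := size_Q_gt1; apply: ramif_dvd.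
have Fi0 : Fi i != 0.
  by apply: contraNneq F_neqtop => Fi0; rewrite -Wi Fi0 mul0r rmorph0 val0.
exists (eval_alpha (Fi 0) / eval_alpha (Fi i)).
  rewrite mulf_neq0 ?invr_eq0 // eval_alpha_eq0 ?size_qcoef //.
  by rewrite -W_neqtop W_coef0.
apply: val_div; first by rewrite eval_alpha_eq0 ?size_qcoef.
by rewrite !v1_eval ?size_qcoef // W_coef0 -Wi WM W_QX addrC.
Qed.

(** The Q-expansion of F is monic of degree I: multiplying F by an inverse of
    its last dominant coefficient modulo Q, and reducing the coefficients
    modulo Q, gives a polynomial of degree I n on which the truncation still
    differs from w. *)
Lemma minimal_size : exists I, [/\ size F = (n * I).+1, W F = W Q *+ I
  & forall i, (I < i)%N -> Fi i = 0].
Proof.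
have Q1 := size_Q_gt1.
have Fi_small i : (size (Fi i) < size Q)%N by apply: size_qcoef.
pose P i := W (Fi i * Q ^+ i) == W F.
have exP : exists i, P i by exists 0%N; rewrite /P expr0 mulr1 W_coef0.
have Fi_big i : (size F <= i)%N -> Fi i = 0.
  move=> Fi; rewrite /qcoef divp_small ?mod0p // size_QX.
  by rewrite (leq_ltn_trans Fi) // ltnS leq_pmull // n_gt0.
have P_neq0 i : P i -> Fi i != 0.
  apply: contraTneq => Fi0; rewrite /P Fi0 mul0r rmorph0 val0 eq_sym.
  exact: F_neqtop.
have P_le i : P i -> (i <= size F)%N.
  by move=> /P_neq0; apply: contraNleq => /ltnW/Fi_big ->.
case: (ex_maxnP exP P_le) => I PI maxI.
have ltI : (I < size F)%N.
  by rewrite ltnNge; apply: contra (P_neq0 I PI) => /Fi_big ->.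
have [g [g0 gQ gF]] := inverse_mod (P_neq0 I PI) (Fi_small I).
(* The reduction modulo Q of the coefficients of g * F up to index I. *)
pose t i := if (i <= I)%N then (g * Fi i) %% Q else 0.
pose H := \sum_(i < size F) t i * Q ^+ i.
have gFH : g * F - H = \sum_(i < size F) (g * Fi i - t i) * Q ^+ i.
  rewrite {1}(qcoef_sum F Q1) mulr_sumr -sumrB; apply: eq_bigr => i _.
  by rewrite mulrBl mulrA.
have WgF : W (g * F) = W g + W F := WM g F.
have gT : W g != top by rewrite W_neqtop.
have lt_gFH : W (g * F) < W (g * F - H).
  rewrite gFH theta_sum; apply: val_lt_sum => [|i _].
    by rewrite neqtop_lt // WgF wt_add_eqtop negb_or gT.
  rewrite WgF /t; case: leqP => [_|Ii].
    have -> : g * Fi i - (g * Fi i) %% Q = g * Fi i %/ Q * Q.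
      by rewrite {1}(divp_eq (g * Fi i) Q) addrK.
    have [Fi0|Fi0] := eqVneq (Fi i) 0.
      rewrite Fi0 mulr0 div0p !mul0r rmorph0 val0 neqtop_lt //.
      by rewrite wt_add_eqtop negb_or gT.
    apply: le_lt_trans (_ : _ <= W g + W (Fi i * Q ^+ i)) _.
      by rewrite wt_leD2l // W_le_term.
    by rewrite WM [ltRHS]WM addrA wt_ltD2r ?W_QX ?gamma_neqtop // W_mod_lt.
  rewrite subr0 -mulrA [ltRHS]WM wt_ltD2l // lt_neqAle W_le_term andbT.
  by rewrite eq_sym; apply: contraTN Ii => /maxI; rewrite -leqNgt.
have W_H : W H = W (g * F).
  by apply: valB_eq; rewrite -thetaB.
have H_lt : W H < wpol w H.
  have HE : H = g * F - (g * F - H) by rewrite opprB addrC subrK.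
  rewrite W_H [in wpol _ _]HE /wpol tofracB; apply: val_gtB.
    by rewrite -/(wpol w _) wpolM WgF -W_small_wpol // wt_ltD2l.
  exact: lt_le_trans lt_gFH (W_le_wpol _).
have sH : (size H <= (n * I).+1)%N.
  apply: size_sum_le => i _; rewrite /t; case: (ltngtP i I) => [iI|Ii|->].
  - by apply/leqW/size_mulQX_le; rewrite ?ltn_modp ?Q_neq0.
  - by rewrite mul0r size_poly0.
  - by rewrite gF mul1r size_QX.
have sF : size F = (n * I).+1.
  apply/eqP; rewrite eqn_leq; apply/andP; split; last first.
    rewrite -size_QX; apply: contraNT (P_neq0 I PI); rewrite -ltnNge => FI.
    by rewrite /qcoef divp_small // mod0p.
  rewrite -(prednK (_ : 0 < size F)%N) ?size_poly_gt0 // ltnS.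
  by apply: leq_trans (F_min H_lt) _; rewrite -subn1 leq_subLR add1n.
exists I; split=> // [|i Ii].
  have F_I : Fi I = 1.
    by rewrite /qcoef monic_divQX // modp_small // size_poly1.
  by rewrite -(eqP PI) F_I mul1r W_QX.
rewrite /qcoef divp_small ?mod0p // size_QX sF ltnS ltn_pmul2l //.
exact: n_gt0.
Qed.

(** The terms of the Q-expansion of F whose exponent is not a multiple of the
    ramification index are negligible, so F has the residue of a polynomial in
    Q ^ e. *)
Lemma minimal_lifts : exists2 G, lifts F G & G`_0 != 0.
Proof.
have Q1 := size_Q_gt1; have [I [sF W_F Fi0]] := minimal_size.
have F_I : Fi I = 1 by rewrite /qcoef monic_divQX // modp_small // size_poly1.
have /dvdnP [m Im] : (e %| I)%N by apply: term_dvd; rewrite F_I mul1r W_QX.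
rewrite mulnC in Im; subst I.
have m0 : (0 < m)%N.
  rewrite lt0n; apply: contra size_F_gt => /eqP m0.
  by rewrite sF m0 !muln0.
have Fi_small j : (size (Fi j) < size Q)%N by apply: size_qcoef.
have le_Fi j : (j <= m)%N -> W Q *+ (e * (m - j)) <= W (Fi (e * j)).
  move=> jm; have := W_le_term F (e * j); rewrite W_F WM W_QX.
  have -> : (e * m = e * (m - j) + e * j)%N by rewrite -mulnDr subnK.
  by rewrite mulrnDr wt_leD2r // gamma_neqtop.
have [ge0 resf] :=
  @res_expansion m (fun j => Fi (e * j)) (fun j _ => Fi_small _) le_Fi.
set f := \sum_(j < m.+1) _ in ge0 resf; set G := \poly_(j < m.+1) _ in resf.
have fE : f = \sum_(i < (e * m).+1 | (e %| i)%N) Fi i * Q ^+ i.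
  by rewrite (sum_dvd_ord m (fun i => Fi i * Q ^+ i)).
have FE : F = \sum_(i < (e * m).+1) Fi i * Q ^+ i.
  have le_sF : ((e * m).+1 <= size F)%N by rewrite sF ltnS leq_pmull // n_gt0.
  rewrite {1}(qcoef_sum F Q1) (big_ord_widen _ (fun i => Fi i * Q ^+ i) le_sF).
  rewrite [RHS]big_mkcond; apply: eq_bigr => i _; rewrite ltnS.
  by case: leqP => // /Fi0 ->; rewrite mul0r.
have lt_Ff : W F < W (F - f).
  have -> : F - f = \sum_(i < (e * m).+1 | ~~ (e %| i)%N) Fi i * Q ^+ i.
    apply/eqP; rewrite subr_eq addrC {1}FE fE.
    by rewrite (bigID (fun i : 'I__ => e %| i)%N).
  rewrite theta_sum.
  apply: val_lt_sum => [|i ei]; first exact: neqtop_lt.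
  by rewrite lt_neqAle W_le_term andbT eq_sym; apply: contra ei => /eqP/term_dvd.
have le_f : W Q *+ (e * m) <= W f.
  by move: ge0; rewrite le_val_div ?theta_h_neq0 // add0r W_hX.
have Gm : G`_m = 1.
  rewrite coef_poly ltnSn F_I subnn expr0 divr1.
  by rewrite /eval_alpha rmorph1 res1.
have sG : size G = m.+1.
  apply/eqP; rewrite eqn_leq size_poly ltnNge; apply/negP => /leq_sizeP/(_ m).
  by rewrite leqnn Gm => /(_ isT)/eqP; rewrite oner_eq0.
exists G; last first.
  rewrite coef_poly muln0 subn0 /= -(res0 v1a) res_eq ?subr0 ?val0 ?le_topr //.
    by rewrite lt_val_div ?eval_h_neq0 // add0r v1_hX v1_eval // W_coef0 W_F ltxx.
  by rewrite le_val_div ?eval_h_neq0 // add0r v1_hX v1_eval // W_coef0 W_F.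
split; rewrite sG //=; split=> //.
- by rewrite monicE /lead_coef sG /= Gm.
- by rewrite sF /= mulnC.
by rewrite -resf; apply/eqP; rewrite res_eq_close -?W_F // W_F.
Qed.

(** Lifting a factorization of G would write F, up to a negligible error, as a
    product of two smaller polynomials, on which the truncation and w agree. *)
Lemma lifts_minimal_irreducible G : lifts F G -> irreducible_poly G.
Proof.
move=> [[_ Gmon G1] [sF W_F resF]]; set m := (size G).-1 in G1 sF W_F resF.
have G0 : G != 0 by apply: monic_neq0.
have G1' : (1 < size G)%N by rewrite -(prednK (_ : 0 < size G)%N) ?size_poly_gt0.
split=> // q q1 qG; apply: contraT => qG'; exfalso.
pose G1m := (lead_coef q)^-1 *: q.
have q0 : q != 0 by apply: contraNneq G0 => q0; move: qG; rewrite q0 dvd0p.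
have lq0 : lead_coef q != 0 by rewrite lead_coef_eq0.
have G1mon : G1m \is monic by rewrite monicE lead_coefZ mulVf.
have sG1 : size G1m = size q by rewrite size_scale // invr_eq0.
have /dvdpP [G2 GE] : G1m %| G by rewrite dvdpZl // invr_eq0.
have G2mon : G2 \is monic by rewrite -(monicMr G2 G1mon) -GE.
have G2_0 : G2 != 0 by apply: monic_neq0.
have q_gt1 : (1 < size G1m)%N by rewrite sG1 ltn_neqAle eq_sym q1 size_poly_gt0.
have G2_gt1 : (1 < size G2)%N.
  rewrite ltn_neqAle eq_sym size_poly_gt0 G2_0 andbT; apply: contra qG' => s1.
  have G2E : G2 = 1.
    have /size_poly1P [c c0 cE] := s1; move: (monicP G2mon).
    by rewrite cE lead_coefC => ->.
  by rewrite GE G2E mul1r /eqp dvdpZr ?dvdpZl ?invr_eq0 // dvdpp.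
have [F1 [[_ _ _] [sF1 W_F1 resF1]]] := lifts_exists G1mon q_gt1.
have [F2 [[_ _ _] [sF2 W_F2 resF2]]] := lifts_exists G2mon G2_gt1.
set d1 := (size G1m).-1 in sF1 W_F1 resF1.
set d2 := (size G2).-1 in sF2 W_F2 resF2.
have d1_gt0 : (0 < d1)%N by rewrite -ltnS prednK // ltnW.
have d2_gt0 : (0 < d2)%N by rewrite -ltnS prednK // ltnW.
have mE : m = (d1 + d2)%N.
  rewrite /m GE size_mul ?monic_neq0 // /d1 /d2 addnC.
  case: (size G1m) q_gt1 (size G2) G2_gt1 => [|a] // _ [|b] //= _.
  by rewrite addnS.
have w_F1 : wpol w F1 = W Q *+ (e * d1).
  rewrite -W_F1 minimal_small // sF sF1 ltn_pmul2r ?n_gt0 // ltn_pmul2l //.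
  by rewrite mE -addn1 leq_add2l.
have w_F2 : wpol w F2 = W Q *+ (e * d2).
  rewrite -W_F2 minimal_small // sF sF2 ltn_pmul2r ?n_gt0 // ltn_pmul2l //.
  by rewrite mE -add1n leq_add2r.
have W_F12 : W (F1 * F2) = W Q *+ (e * m).
  by rewrite WM W_F1 W_F2 -mulrnDr -mulnDr mE.
have : W Q *+ (e * m) < W (F - F1 * F2).
  rewrite -res_eq_close ?W_F ?W_F12 // resF GE map_emb_M hornerM.
  rewrite -resF1 -resF2 mulrC -resM; last 2 first.
  - by rewrite le_val_div ?theta_h_neq0 // add0r W_hX W_F1.
  - by rewrite le_val_div ?theta_h_neq0 // add0r W_hX W_F2.
  by rewrite thetaM mE exprD invfM mulrACA.
move/lt_le_trans/(_ (W_le_wpol _)) => lt_d.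
have : W Q *+ (e * m) < wpol w (F1 * F2).
  have -> : F1 * F2 = F - (F - F1 * F2) by rewrite opprB addrC subrK.
  by rewrite /wpol tofracB; apply: val_gtB => //; rewrite -W_F.
by rewrite wpolM w_F1 w_F2 -mulrnDr -mulnDr -mE ltxx.
Qed.

End Minimal.

Lemma size_monicB f g : f \is monic -> g \is monic -> size f = size g ->
  (size (f - g)%R < size f)%N.
Proof.
move=> fmon gmon fg; have sf : (0 < size f)%N by rewrite size_poly_gt0 monic_neq0.
rewrite -(prednK sf) ltnS; apply/leq_sizeP => j; rewrite coefB leq_eqVlt.
case/predU1P=> [<-|lt_j].
  have := monicP fmon; have := monicP gmon.
  by rewrite /lead_coef fg => -> ->; rewrite subrr.
by rewrite !nth_default ?subr0 -?fg // -(prednK sf).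
Qed.

(** Liftings of the same polynomial differ by something negligible for the
    Gauss valuation, hence for w; conversely F - F' has degree less than n, so
    its value is the same for the Gauss valuation and for w. *)
Lemma lifts_minimalP F F' G : minimal F -> lifts F G ->
  (lifts F' G /\ (size F').-1 = n) <-> (minimal F' /\ (size F').-1 = n).
Proof.
move=> [Fmon F_lt F_min] [[_ Gmon G1] [sF W_F resF]].
set m := (size G).-1 in G1 sF W_F resF *.
split=> [] [] F'P; last first.
  have [F'mon F'_lt F'_min] := F'P; move=> sF'; split=> //.
  have sFF' : (size F').-1 = (size F).-1.
    by apply/eqP; rewrite eqn_leq F'_min ?F_min.
  have [G' [[_ _ _] [sF'' W_F' _]] _] := minimal_lifts F'P.
  have mE : (size G').-1 = m.
    apply/eqP; rewrite -(eqn_pmul2l e_gt0) -(eqn_pmul2r n_gt0).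
    by rewrite -sF'' -sF sFF'.
  rewrite mE in sF'' W_F'; split; rewrite -/m //; split=> //.
  rewrite -resF; apply/eqP; rewrite res_eq_close ?W_F ?W_F' //.
  have F0 : (0 < size F)%N by rewrite size_poly_gt0 monic_neq0.
  have F'0 : (0 < size F')%N by rewrite size_poly_gt0 monic_neq0.
  have sQ : size F' = size Q.
    by rewrite -(prednK F'0) sF' prednK // size_poly_gt0 Q_neq0.
  rewrite (@W_small_wpol (F' - F)); last first.
    rewrite -sQ size_monicB // -(prednK F0) -(prednK F'0); congr _.+1.
    by rewrite sFF'.
  by rewrite /wpol tofracB; apply: val_gtB; [rewrite -W_F' | rewrite -W_F].
have [[F'mon _ _] [sF' W_F' resF']] := F'P; move=> sFn; split=> //.
have sFF' : (size F).-1 = (size F').-1 by rewrite sF sF'.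
split=> [//||f]; last by rewrite -sFF'; apply: F_min.
have lt_d : W Q *+ (e * m) < W (F' - F).
  by rewrite -res_eq_close ?W_F ?W_F' // resF resF'.
have FE : F' = (F' - F) + F by rewrite subrK.
rewrite W_F' [in wpol _ _]FE /wpol tofracD; apply: val_gtD.
  exact: lt_le_trans lt_d (W_le_wpol _).
by rewrite -W_F.
Qed.

Lemma psiE F : psi w Q F <-> minimal F.
Proof.
split=> [[Fmon F_lt [_ F_min]]|[Fmon F_lt F_min]].
  by split=> // [|f f_lt]; [rewrite -truncE | apply: F_min; rewrite truncE].
split=> //; first by rewrite truncE.
by split=> [|f]; [exists F => //; rewrite truncE | rewrite truncE; apply: F_min].
Qed.

(** A polynomial of least degree, divided by its leading coefficient, on whose
    inverse W and w agree. *)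
Lemma minimal_exists : trunc_proper w Q -> exists F, minimal F.
Proof.
case=> f; rewrite truncE => /eqP f_neq.
have {f_neq} f_lt : W f < wpol w f by rewrite lt_neqAle f_neq W_le_wpol.
have [k fk] : exists k, ((size f).-1 < k)%N by exists (size f).-1.+1.
elim: k f f_lt fk => // k IH f f_lt fk.
have [[g [g_lt gf]]|no_g] := classic (exists g, W g < wpol w g /\
  ((size g).-1 < (size f).-1)%N).
  by apply: (IH g g_lt); apply: leq_trans gf _; rewrite -ltnS.
have f0 : f != 0 by rewrite -W_neqtop (lt_neqtop f_lt).
have lf0 : (lead_coef f)^-1 != 0 by rewrite invr_eq0 lead_coef_eq0.
have C1 := size_Q_gt1.
exists ((lead_coef f)^-1 *: f); split.
- by rewrite monicE lead_coefZ mulVf // lead_coef_eq0.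
- have cQ : (size (lead_coef f)^-1%:P < size Q)%N by rewrite size_polyC lf0.
  rewrite -mul_polyC WM wpolM -W_small_wpol // wt_ltD2l //.
  by rewrite W_neqtop polyC_eq0.
move=> g g_lt; rewrite size_scale // leqNgt; apply/negP => gf.
by apply: no_g; exists g.
Qed.

End Truncation.
(** * Key polynomials and liftings *)

Theorem theorem1p12 (V : ordQVectType)
    (K : fieldType) (v : valuation V K)
    (Kbar : closedFieldType) (iota : {rmorphism K -> Kbar})
    (Kbar_closure : alg_closure iota)
    (v_henselian : henselian iota v)
    (vbar : valuation V Kbar) (vbar_v : extends iota v vbar)
    (w : valuation V {fraction {poly K}}) (w_v : extends (@ratC K) v w)
    (wbar : valuation V {fraction {poly Kbar}})
    (wbar_w : extends (ratmap iota) w wbar)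
    (wbar_vbar : extends (@ratC Kbar) vbar wbar)
    (Q : {poly K}) (Q_ABKP : ABKP w Q) (wQ_lt_w : trunc_proper w Q)
    (alpha : Kbar) (alpha_opt : optimizing_root iota wbar Q alpha)
    (e : nat) (e_min : is_ramif iota vbar w Q alpha e)
    (h : {poly K}) (h_norm : is_normalizer iota vbar w Q alpha e h) :
  (exists G : {poly resfield (v1 iota vbar Q alpha)},
     [/\ G \is monic, irreducible_poly G, G <> 'X
       & forall F : {poly K},
           trivial_lifting w wbar e h F G <->
           psi w Q F /\ (size F).-1 = (size Q).-1]) /\
  (forall F : {poly K}, psi w Q F -> ((size Q).-1 < (size F).-1)%N ->
     exists G : {poly resfield (v1 iota vbar Q alpha)},
       [/\ G \is monic, G <> 'X & nontrivial_lifting w wbar e h F G]).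
Proof.
pose u := wad vbar wbar alpha.
have u_vbar : extends (@ratC Kbar) vbar u by apply: gauss_extends.
have u_XsubC b : u (tofrac ('X - b%:P)) =
    Order.min (vbar (alpha - b)) (wbar_lin wbar alpha).
  rewrite [LHS]gauss_XsubC /deltaQ finK //.
  by rewrite val_neqtop tofrac_eq0 polyXsubC_eq0.
have u_le p : u (tofrac p) <= vbar p.[alpha] by apply: gauss_le_horner.
have tE := truncE wbar_w wbar_vbar Q_ABKP alpha_opt u_vbar u_XsubC u_le.
have psiE := psiE wbar_w wbar_vbar Q_ABKP alpha_opt u_vbar u_XsubC u_le.
case: e_min => e_gt0 _ e_le; case: h_norm => h_small W_h _.
rewrite /gammaQ !tE in W_h.
have {}e_le e' : (0 < e')%N -> in_value_group (v1 iota vbar Q alpha)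
    (u (tofrac (map_poly iota Q)) *+ e') -> (e <= e')%N.
  by rewrite -tE; apply: e_le.
have h0 : h != 0.
  exact: (h_neq0 Q_ABKP W_h).
have liftingE F (G : {poly resfield (v1 iota vbar Q alpha)}) :
    lifting w wbar e h F G <-> lifts u e h F G.
  have thX f k : tofrac (map_poly iota (f ^+ k)) = tofrac (map_poly iota f) ^+ k.
    by rewrite rmorphXn tofracXn.
  have Qe : wQ_res iota vbar wbar alpha (tofrac (Q ^+ e) / tofrac h) =
      res u (tofrac (map_poly iota Q) ^+ e / tofrac (map_poly iota h)).
    by congr (res u _); rewrite -thX; apply: ratmap_div.
  have Fh m : wQ_res iota vbar wbar alpha (tofrac F / tofrac (h ^+ m)) =
      res u (tofrac (map_poly iota F) / tofrac (map_poly iota h) ^+ m).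
    by congr (res u _); rewrite -thX; apply/ratmap_div/expf_neq0.
  rewrite /lifting /lifts Qe Fh /gammaQ !tE.
  split=> [[P [sF _ W_F resF]]|[P [sF W_F resF]]].
    exact: conj P (And3 sF W_F resF).
  split; first exact: P.
  split; [exact: sF | | exact: W_F | exact: resF].
  by rewrite W_F thX valX W_h -mulrnA.
have lift_psi F : minimal iota w u F ->
    exists2 G : {poly resfield (v1 iota vbar Q alpha)},
      lifts u e h F G & G <> 'X.
  move=> F_min; have [G FG G0] := minimal_lifts wbar_w wbar_vbar Q_ABKP alpha_opt
    u_vbar u_XsubC u_le e_gt0 h_small W_h e_le F_min.
  by exists G => // GX; move: G0; rewrite GX coefX eqxx.
split=> [|F /psiE F_min sF]; last first.
  have [G FG GX] := lift_psi F F_min; exists G; split=> //.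
    by case: FG => [[]].
  by split; [apply/liftingE | apply/eqP; rewrite gtn_eqF].
have [F0 F0_min] := minimal_exists wbar_w wbar_vbar Q_ABKP alpha_opt
  u_vbar u_XsubC u_le wQ_lt_w.
have [G FG GX] := lift_psi F0 F0_min; exists G; split=> // [||F].
- by case: FG => [[]].
- exact: (lifts_minimal_irreducible wbar_w wbar_vbar Q_ABKP alpha_opt
    u_vbar u_XsubC u_le e_gt0 h_small W_h F0_min FG).
rewrite /trivial_lifting liftingE psiE.
exact: (lifts_minimalP wbar_w wbar_vbar Q_ABKP alpha_opt
    u_vbar u_XsubC u_le e_gt0 h_small W_h e_le F F0_min FG).
Qed.
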